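(* If $\alpha=(\alpha_1,\ldots,\alpha_\ell)$ is a composition of $n$, then there are isomorphisms of $\mathcal H_n(0)$-modules $$\mathbf M_\alpha\ \cong\ \left(\mathbf P_{\alpha_1}\otimes\cdots\otimes\mathbf P_{\alpha_\ell}\right)\uparrow_{\mathcal H_\alpha(0)}^{\mathcal H_n(0)}\ \cong\ \bigoplus_{\beta\preccurlyeq\alpha}\mathbf P_\beta .$$
   Context: $\mathbb F$ is an arbitrary field. $\mathcal H_n(0)$ is the $\mathbb F$-algebra generated by $\pi_1,\ldots,\pi_{n-1}$ with relations $\pi_i^2=\pi_i$ and the braid relations of $\mathfrak S_n$; $\overline\pi_i:=\pi_i-1$. A composition $\alpha=(\alpha_1,\ldots,\alpha_\ell)$ of $n$ is a sequence of positive integers with sum $n$; $D(\alpha)=\{\alpha_1,\alpha_1+\alpha_2,\ldots,\alpha_1+\cdots+\alpha_{\ell-1}\}$. For compositions of the same size, $\beta\preccurlyeq\alpha$ means $D(\beta)\subseteq D(\alpha)$. $\alpha$ is identified with its ribbon diagram: rows of lengths $\alpha_1,\ldots,\alpha_\ell$ from bottom to top, the last box of each row lying directly below the first box of the next row up. A generalized ribbon $\alpha^1\oplus\cdots\oplus\alpha^k$ is a skew diagram whose connected components are ribbons $\alpha^1,\ldots,\alpha^k$, with $\alpha^{i+1}$ strictly to the northeast of $\alpha^i$. A standard tableau of generalized ribbon shape of size $n$ is a filling of the boxes with $1,\ldots,n$, each used once, rows increasing left to right and columns increasing top to bottom. For a generalized ribbon $\gamma$ of size $n$, $\mathbf P_\gamma$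 is the $\mathcal H_n(0)$-module over $\mathbb F$ with basis the standard tableaux $\tau$ of shape $\gamma$ and action: $\overline\pi_i(\tau)=-\tau$ if $i$ is in a higher row of $\tau$ than $i+1$; $\overline\pi_i(\tau)=0$ if $i,i+1$ are in the same row; $\overline\pi_i(\tau)=s_i(\tau)$ (swap the entries $i$ and $i+1$) if $i$ is in a lower row than $i+1$. For a composition $\alpha=(\alpha_1,\ldots,\alpha_\ell)$, $\mathbf M_\alpha:=\mathbf P_{\alpha_1\oplus\cdots\oplus\alpha_\ell}$, where $\alpha_i$ denotes the one-row ribbon with $\alpha_i$ boxes; thus $\mathbf P_{\alpha_i}$ is the one-dimensional $\mathcal H_{\alpha_i}(0)$-module on which all $\overline\pi_j$ act by $0$. $\mathcal H_\alpha(0)\cong\mathcal H_{\alpha_1}(0)\otimes\cdots\otimes\mathcal H_{\alpha_\ell}(0)$ is the subalgebra of $\mathcal H_n(0)$ generated by the $\pi_i$ with $i\in\{1,\ldots,n-1\}\setminus D(\alpha)$. $N\uparrow_B^A:=A\otimes_BN$. *)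

(* Defs.v *)
From HB Require Import structures.
From mathcomp Require Import all_boot all_order all_algebra perm.
From mathcomp Require Import zify ring.
From mathcomp Require Import boolp.

Set Implicit Arguments.
Unset Strict Implicit.
Unset Printing Implicit Defensive.

Import GRing.Theory.
Local Open Scope ring_scope.
Local Open Scope quotient_scope.

(* Indices are shifted by one throughout: [i : 'I_n.-1] stands for the        *)
(* generator pi_(i+1), and [k : 'I_n] for the tableau entry k+1.              *)

Inductive hterm (F : Type) (n : nat) : Type :=
| HConst of F
| HGen of 'I_n.-1
| HAdd of hterm F n & hterm F n
| HMul of hterm F n & hterm F n.
Arguments HConst {F n}.
Arguments HGen {F n}.

HB.instance Definition _ F n := gen_eqMixin (hterm F n).
HB.instance Definition _ F n := gen_choiceMixin (hterm F n).

(* The smallest congruence satisfying the axioms of associative unital        *)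
(* F-algebras and the defining relations of H_n(0).                           *)
Inductive heq (F : fieldType) (n : nat) : hterm F n -> hterm F n -> Prop :=
| heq_refl t : heq t t
| heq_sym t u : heq t u -> heq u t
| heq_trans t u v : heq t u -> heq u v -> heq t v
| heq_add t t' u u' : heq t t' -> heq u u' -> heq (HAdd t u) (HAdd t' u')
| heq_mul t t' u u' : heq t t' -> heq u u' -> heq (HMul t u) (HMul t' u')
| heq_addA t u v : heq (HAdd t (HAdd u v)) (HAdd (HAdd t u) v)
| heq_addC t u : heq (HAdd t u) (HAdd u t)
| heq_add0 t : heq (HAdd (HConst 0) t) t
| heq_addN t : heq (HAdd (HMul (HConst (-1)) t) t) (HConst 0)
| heq_mulA t u v : heq (HMul t (HMul u v)) (HMul (HMul t u) v)
| heq_mul1l t : heq (HMul (HConst 1) t) t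
| heq_mul1r t : heq (HMul t (HConst 1)) t
| heq_mulDl t u v : heq (HMul (HAdd t u) v) (HAdd (HMul t v) (HMul u v))
| heq_mulDr t u v : heq (HMul t (HAdd u v)) (HAdd (HMul t u) (HMul t v))
| heq_constD a b : heq (HConst (a + b)) (HAdd (HConst a) (HConst b))
| heq_constM a b : heq (HConst (a * b)) (HMul (HConst a) (HConst b))
| heq_constC a t : heq (HMul (HConst a) t) (HMul t (HConst a))
| heq_idem (i : 'I_n.-1) : heq (HMul (HGen i) (HGen i)) (HGen i)
| heq_comm (i j : 'I_n.-1) : (i.+1 < j)%N ->
    heq (HMul (HGen i) (HGen j)) (HMul (HGen j) (HGen i))
| heq_braid (i j : 'I_n.-1) : j = i.+1 :> nat ->
    heq (HMul (HGen i) (HMul (HGen j) (HGen i)))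
        (HMul (HGen j) (HMul (HGen i) (HGen j))).

Section GeneratorActions.
Variables (F : fieldType) (n : nat).

(* An F-linear action of the generators satisfying the defining relations.    *)
Record gen_action (V : lmodType F) := GenAction {
  hop :> 'I_n.-1 -> V -> V;
  hop_linear : forall i, linear (hop i);
  hop_idem : forall i v, hop i (hop i v) = hop i v;
  hop_comm : forall i j : 'I_n.-1, (i.+1 < j)%N ->
    forall v, hop i (hop j v) = hop j (hop i v);
  hop_braid : forall i j : 'I_n.-1, j = i.+1 :> nat ->
    forall v, hop i (hop j (hop i v)) = hop j (hop i (hop j v))
}.

Variables (V : lmodType F) (act : gen_action V).

Fixpoint heval (t : hterm F n) (v : V) : V :=
  match t with
  | HConst a => a *: v
  | HGen i => act i v
  | HAdd t u => heval t v + heval u v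
  | HMul t u => heval t (heval u v)
  end.

Lemma heval_linear t : linear (heval t).
Proof.
elim: t => [b|i|t IHt u IHu|t IHt u IHu] a v w /=.
- by rewrite scalerDr !scalerA mulrC.
- exact: hop_linear.
- by rewrite IHt IHu scalerDr addrACA.
- by rewrite IHu IHt.
Qed.

Lemma hevalD t v w : heval t (v + w) = heval t v + heval t w.
Proof. by have := heval_linear t 1 v w; rewrite !scale1r. Qed.

Lemma heval0 t : heval t 0 = 0.
Proof. by apply: (addrI (heval t 0)); rewrite -hevalD !addr0. Qed.

Lemma hevalZ t a v : heval t (a *: v) = a *: heval t v.
Proof. by have := heval_linear t a v 0; rewrite heval0 !addr0. Qed.

Lemma heval_heq t u : heq t u -> heval t =1 heval u.
Proof.
elim=> {t u} //=.
- by move=> t u _ IH x; rewrite IH.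
- by move=> t u v _ IH1 _ IH2 x; rewrite IH1.
- by move=> t t' u u' _ IH1 _ IH2 x; rewrite IH1 IH2.
- by move=> t t' u u' _ IH1 _ IH2 x; rewrite IH2 IH1.
- by move=> t u v x; rewrite addrA.
- by move=> t u x; rewrite addrC.
- by move=> t x; rewrite scale0r add0r.
- by move=> t x; rewrite scaleN1r addNr scale0r.
- by move=> t x; rewrite scale1r.
- by move=> t x; rewrite scale1r.
- by move=> t u v x; rewrite hevalD.
- by move=> a b x; rewrite scalerDl.
- by move=> a b x; rewrite scalerA.
- by move=> a t x; rewrite hevalZ.
- by move=> i x; rewrite hop_idem.
- by move=> i j ij x; apply: hop_comm.
- by move=> i j ij x; apply: hop_braid.
Qed.

End GeneratorActions.

Definition triv_action (F : fieldType) n : gen_action n F^o.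
Proof. by exists (fun _ v => v). Defined.

Definition heqb (F : fieldType) n (t u : hterm F n) : bool := `[< heq t u >].

Lemma heqb_equiv (F : fieldType) n : equiv_class_of (@heqb F n).
Proof.
split=> [t|t u|u t v].
- by apply/asboolP/heq_refl.
- by apply/asboolP/asboolP => /heq_sym.
- by move=> /asboolP tu /asboolP uv; apply/asboolP/(heq_trans tu uv).
Qed.

Canonical heqb_rel (F : fieldType) n := EquivRelPack (@heqb_equiv F n).

Definition hecke0 (F : fieldType) (n : nat) : Type := {eq_quot (heqb_rel F n)}.

Section HeckeAlgebra.
Variables (F : fieldType) (n : nat).
Local Notation H := (hecke0 F n).

HB.instance Definition _ := EqQuotient.copy H {eq_quot (heqb_rel F n)}.
HB.instance Definition _ := Choice.copy H {eq_quot (heqb_rel F n)}.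

Definition hpi_term (t : hterm F n) : H := \pi_H t.

Lemma hpi_termP t u : reflect (heq t u) (hpi_term t == hpi_term u).
Proof. by rewrite /hpi_term eqmodE; apply: asboolP. Qed.

Lemma hpi_term_eq t u : heq t u -> hpi_term t = hpi_term u.
Proof. by move=> /hpi_termP/eqP. Qed.

Lemma heq_repr t : heq (repr (hpi_term t)) t.
Proof. by apply/hpi_termP; rewrite /hpi_term reprK. Qed.

Lemma hecke_ind (P : H -> Prop) :
  (forall t, P (hpi_term t)) -> forall x, P x.
Proof. by move=> Pt x; rewrite -[x]reprK; apply: Pt. Qed.

Definition hadd (x y : H) : H := hpi_term (HAdd (repr x) (repr y)).
Definition hmul (x y : H) : H := hpi_term (HMul (repr x) (repr y)).
Definition hconst (a : F) : H := hpi_term (HConst a).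
Definition hopp (x : H) : H := hmul (hconst (-1)) x.
Definition hscale (a : F) (x : H) : H := hmul (hconst a) x.

Lemma haddE t u : hadd (hpi_term t) (hpi_term u) = hpi_term (HAdd t u).
Proof. by apply: hpi_term_eq; apply: heq_add; apply: heq_repr. Qed.

Lemma hmulE t u : hmul (hpi_term t) (hpi_term u) = hpi_term (HMul t u).
Proof. by apply: hpi_term_eq; apply: heq_mul; apply: heq_repr. Qed.

Fact haddA : associative hadd.
Proof.
elim/hecke_ind=> t; elim/hecke_ind=> u; elim/hecke_ind=> v.
by rewrite !haddE; apply/hpi_term_eq/heq_addA.
Qed.
Fact haddC : commutative hadd.
Proof.
elim/hecke_ind=> t; elim/hecke_ind=> u.
by rewrite !haddE; apply/hpi_term_eq/heq_addC.
Qed.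
Fact hadd0 : left_id (hconst 0) hadd.
Proof. by elim/hecke_ind=> t; rewrite haddE; apply/hpi_term_eq/heq_add0. Qed.
Fact haddN : left_inverse (hconst 0) hopp hadd.
Proof.
by elim/hecke_ind=> t; rewrite /hopp hmulE haddE; apply/hpi_term_eq/heq_addN.
Qed.
Fact hmulA : associative hmul.
Proof.
elim/hecke_ind=> t; elim/hecke_ind=> u; elim/hecke_ind=> v.
by rewrite !hmulE; apply/hpi_term_eq/heq_mulA.
Qed.
Fact hmul1l : left_id (hconst 1) hmul.
Proof. by elim/hecke_ind=> t; rewrite hmulE; apply/hpi_term_eq/heq_mul1l. Qed.
Fact hmul1r : right_id (hconst 1) hmul.
Proof. by elim/hecke_ind=> t; rewrite hmulE; apply/hpi_term_eq/heq_mul1r. Qed.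
Fact hmulDl : left_distributive hmul hadd.
Proof.
elim/hecke_ind=> t; elim/hecke_ind=> u; elim/hecke_ind=> v.
by rewrite !(hmulE, haddE); apply/hpi_term_eq/heq_mulDl.
Qed.
Fact hmulDr : right_distributive hmul hadd.
Proof.
elim/hecke_ind=> t; elim/hecke_ind=> u; elim/hecke_ind=> v.
by rewrite !(hmulE, haddE); apply/hpi_term_eq/heq_mulDr.
Qed.
Fact hone_neq0 : hconst 1 != hconst 0.
Proof.
apply/hpi_termP => /(@heval_heq F n _ (triv_action F n)) /(_ (1 : F^o)) /=.
by rewrite scale1r scale0r => /eqP; rewrite oner_eq0.
Qed.

HB.instance Definition _ := GRing.isZmodule.Build H haddA haddC hadd0 haddN.
HB.instance Definition _ :=
  GRing.Zmodule_isNzRing.Build H hmulA hmul1l hmul1r hmulDl hmulDr hone_neq0.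

Fact hscaleA a b (x : H) : hscale a (hscale b x) = hscale (a * b) x.
Proof.
rewrite /hscale hmulA; congr (hmul _ _).
by rewrite hmulE; apply/esym/hpi_term_eq/heq_constM.
Qed.
Fact hscale1 : left_id 1 hscale.
Proof. exact: hmul1l. Qed.
Fact hscaleDr : right_distributive hscale +%R.
Proof. by move=> a x y; apply: hmulDr. Qed.
Fact hscaleDl (x : H) : {morph hscale^~ x : a b / a + b}.
Proof.
move=> a b; rewrite /hscale /= -[RHS]hmulDl; congr (hmul _ _).
by rewrite haddE; apply/hpi_term_eq/heq_constD.
Qed.

HB.instance Definition _ := GRing.Zmodule_isLmodule.Build F H
  hscaleA hscale1 hscaleDr hscaleDl.

Fact hscaleAl a (x y : H) : a *: (x * y) = (a *: x) * y.
Proof. exact: hmulA. Qed.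
HB.instance Definition _ := GRing.Lmodule_isLalgebra.Build F H hscaleAl.

Fact hscaleAr a (x y : H) : a *: (x * y) = x * (a *: y).
Proof.
suff cC : hmul (hconst a) x = hmul x (hconst a).
  by rewrite -[LHS]/(hmul _ (hmul _ _)) hmulA cC -hmulA.
by elim/hecke_ind: x => t; rewrite !hmulE; apply/hpi_term_eq/heq_constC.
Qed.
HB.instance Definition _ := GRing.Lalgebra_isAlgebra.Build F H hscaleAr.

Definition hpi (i : 'I_n.-1) : H := hpi_term (HGen i).

Lemma hpi_idem i : hpi i * hpi i = hpi i.
Proof. by rewrite -[LHS]/(hmul _ _) hmulE; apply/hpi_term_eq/heq_idem. Qed.

Lemma hpi_comm (i j : 'I_n.-1) : (i.+1 < j)%N -> hpi i * hpi j = hpi j * hpi i.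
Proof.
move=> ij; rewrite -[LHS]/(hmul _ _) -[RHS]/(hmul _ _) !hmulE.
by apply/hpi_term_eq/heq_comm.
Qed.

Lemma hpi_braid (i j : 'I_n.-1) : j = i.+1 :> nat ->
  hpi i * (hpi j * hpi i) = hpi j * (hpi i * hpi j).
Proof.
move=> ij; rewrite -[LHS]/(hmul _ (hmul _ _)) -[RHS]/(hmul _ (hmul _ _)).
rewrite (hmulE (HGen i) (HGen j)) (hmulE (HGen j) (HGen i)) !hmulE.
by apply: hpi_term_eq; apply: heq_braid.
Qed.

Definition hpibar (i : 'I_n.-1) : H := hpi i - 1.

End HeckeAlgebra.

(* The H_n(0)-module determined by an action of the generators.               *)
Definition hmod (F : fieldType) n (V : lmodType F) (act : gen_action n V) : Type
  := V.

Section HModule.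
Variables (F : fieldType) (n : nat) (V : lmodType F) (act : gen_action n V).
Local Notation M := (hmod act).
Local Notation H := (hecke0 F n).

HB.instance Definition _ := GRing.Zmodule.copy M V.

Definition hact (x : H) (v : M) : M := heval act (repr x) v.

Lemma hactE t v : hact (hpi_term t) v = heval act t v.
Proof. by apply: heval_heq; apply: heq_repr. Qed.

Fact hactA (x y : H) (v : M) : hact x (hact y v) = hact (x * y) v.
Proof.
elim/hecke_ind: x => t; elim/hecke_ind: y => u.
by rewrite -[_ * _]/(hmul _ _) hmulE !hactE.
Qed.
Fact hact1 : left_id 1 hact.
Proof. by move=> v; rewrite hactE /= scale1r. Qed.
Fact hactDr : right_distributive hact +%R.
Proof. by move=> x v w; apply: hevalD. Qed.
Fact hactDl (v : M) : {morph hact^~ v : x y / x + y}.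
Proof.
elim/hecke_ind=> t; elim/hecke_ind=> u.
by rewrite -[_ + _]/(hadd _ _) haddE !hactE.
Qed.

HB.instance Definition _ := GRing.Zmodule_isLmodule.Build H M
  hactA hact1 hactDr hactDl.

Lemma hpiE (i : 'I_n.-1) (v : M) : hpi F i *: v = act i v.
Proof. exact: hactE. Qed.

Lemma hscalarE (a : F) (v : M) : (a%:A : H) *: v = (a *: (v : V)).
Proof.
have -> : a%:A = hconst n a by apply: hmul1r.
exact: hactE.
Qed.

End HModule.

(* A box is a pair (row, column); rows are numbered from bottom to top and    *)
(* columns from left to right, so a higher row has a larger row number.       *)
Definition box : Type := (nat * nat)%type.
HB.instance Definition _ := Choice.copy box (nat * nat)%type.
HB.instance Definition _ := Countable.copy box (nat * nat)%type.

Definition brow (b : box) : nat := b.1.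
Definition bcol (b : box) : nat := b.2.

Definition row_boxes (r c m : nat) : seq box := [seq (r, (c + k)%N) | k <- iota 0 m].

(* The ribbon of alpha whose bottom left box is (r, c): a row of length m     *)
(* starting in column c ends in column c + m - 1, where the next row starts.  *)
Fixpoint ribbon_boxes (r c : nat) (alpha : seq nat) : seq box :=
  if alpha is m :: alpha' then
    row_boxes r c m ++ ribbon_boxes r.+1 (c + m).-1 alpha'
  else [::].

(* A ribbon of alpha occupies [size alpha] rows and                           *)
(* [sumn alpha - (size alpha - 1)] columns.                                   *)
Fixpoint gribbon_boxes (r c : nat) (gamma : seq (seq nat)) : seq box :=
  if gamma is alpha :: gamma' then
    ribbon_boxes r c alpha ++
    gribbon_boxes (r + size alpha) (c + (sumn alpha - (size alpha).-1)) gamma'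
  else [::].

(* The diagram of alpha^1 (+) ... (+) alpha^k.                                *)
Definition gribbon (gamma : seq (seq nat)) : seq box := gribbon_boxes 0 0 gamma.

Section Tableaux.
Variables (n : nat) (d : seq box).

Definition is_standard (f : {ffun seq_sub d -> 'I_n}) : bool :=
  [&& injectiveb f,
      [forall k, k \in codom f],
      [forall b, forall b',
        (brow (val b) == brow (val b')) && (bcol (val b) < bcol (val b'))%N
          ==> (f b < f b')%N] &
      [forall b, forall b',
        (bcol (val b) == bcol (val b')) && (brow (val b') < brow (val b))%N
          ==> (f b < f b')%N]].

(* There are none unless n is the number of boxes of d.                       *)
Record tableau := Tableau {
  filling :> {ffun seq_sub d -> 'I_n};
  fillingP : is_standard filling
}.

HB.instance Definition _ := [isSub for filling].
HB.instance Definition _ := [Finite of tableau by <:].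

Definition entry_row (t : tableau) (k : 'I_n) : nat :=
  if [pick b | t b == k] is Some b then brow (val b) else 0.

(* The entries exchanged by s_i.                                              *)
Definition ent0 (i : 'I_n.-1) : 'I_n := widen_ord (leq_pred n) i.
Fact ent1_subproof (i : 'I_n.-1) : (i.+1 < n)%N.
Proof. by case: i => i /=; lia. Qed.
Definition ent1 (i : 'I_n.-1) : 'I_n := Ordinal (ent1_subproof i).

Definition swap_filling i (t : tableau) : {ffun seq_sub d -> 'I_n} :=
  [ffun b => tperm (ent0 i) (ent1 i) (t b)].

(* s_i(t) when this is standard, for instance if i is in a lower row than i+1 *)
(* (see [swapE]); t itself otherwise.                                         *)
Definition swap i (t : tableau) : tableau := insubd t (swap_filling i t).

Lemma tab_inj (t : tableau) : injective t.
Proof. by case: t => f /= /and4P[/injectiveP]. Qed.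

Lemma tab_surj (t : tableau) k : exists b, t b = k.
Proof.
by case: t => f /= /and4P[_ /forallP/(_ k)/codomP[b ->] _ _]; exists b.
Qed.

Lemma entry_rowE (t : tableau) b : entry_row t (t b) = brow (val b).
Proof.
rewrite /entry_row; case: pickP => [b' /eqP/tab_inj -> //|/(_ b)].
by rewrite eqxx.
Qed.

Lemma tperm_mono (i : 'I_n.-1) (x y : 'I_n) :
  (x < y)%N -> (x != ent0 i) || (y != ent1 i) ->
  (tperm (ent0 i) (ent1 i) x < tperm (ent0 i) (ent1 i) y)%N.
Proof.
rewrite -!val_eqE /=.
by do 2![case: tpermP => [->|->|/eqP + /eqP]; rewrite -?val_eqE /=]; lia.
Qed.

Lemma swapE i (t : tableau) :
  (entry_row t (ent0 i) < entry_row t (ent1 i))%N ->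
  val (swap i t) = swap_filling i t.
Proof.
move=> lt_row; rewrite insubdK //; apply/and4P; split.
- by apply/injectiveP => b b'; rewrite !ffunE => /perm_inj/tab_inj.
- apply/forallP => k; have [b tb] := tab_surj t (tperm (ent0 i) (ent1 i) k).
  by apply/codomP; exists b; rewrite ffunE tb tpermK.
- have /and4P[_ _ /'forall_forallP tr _] := fillingP t.
  apply/'forall_forallP => b b'; apply/implyP => /andP[rbb cbb]; rewrite !ffunE.
  apply: tperm_mono; first by have := tr b b'; rewrite rbb cbb.
  apply: contraTT lt_row; rewrite negb_or !negbK => /andP[/eqP <- /eqP <-].
  by rewrite !entry_rowE (eqP rbb) ltnn.
- have /and4P[_ _ _ /'forall_forallP tr] := fillingP t.
  apply/'forall_forallP => b b'; apply/implyP => /andP[rbb cbb]; rewrite !ffunE.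
  apply: tperm_mono; first by have := tr b b'; rewrite rbb cbb.
  apply: contraTT lt_row; rewrite negb_or !negbK => /andP[/eqP <- /eqP <-].
  by rewrite !entry_rowE -leqNgt ltnW.
Qed.

Lemma entry_row_swap i (t : tableau) k :
  (entry_row t (ent0 i) < entry_row t (ent1 i))%N ->
  entry_row (swap i t) k = entry_row t (tperm (ent0 i) (ent1 i) k).
Proof.
move=> lt_row; have [b tb] := tab_surj (swap i t) k.
rewrite -{1}tb entry_rowE -tb.
have -> : swap i t b = tperm (ent0 i) (ent1 i) (t b).
  by rewrite -[filling _]/(val _) swapE // ffunE.
by rewrite tpermK entry_rowE.
Qed.

End Tableaux.
Arguments ent0 {n} i.
Arguments ent1 {n} i.

Section ModuleP.
Variables (F : fieldType) (n : nat) (d : seq box).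
Local Notation X := (tableau n d).
Local Notation V := {ffun X -> F^o}.

Definition basisv (x : X) : V := [ffun y => (y == x)%:R].

(* The action of pi_i - 1 on the basis, and its linear extension.             *)
Definition bar_basis (i : 'I_n.-1) (t : X) : V :=
  if (entry_row t (ent1 i) < entry_row t (ent0 i))%N then - basisv t
  else if entry_row t (ent0 i) == entry_row t (ent1 i) then 0
  else basisv (swap i t).

Definition bar_op (i : 'I_n.-1) (v : V) : V := \sum_t v t *: bar_basis i t.

Definition P_op (i : 'I_n.-1) (v : V) : V := bar_op i v + v.

Lemma basisv_expand (v : V) : v = \sum_t v t *: basisv t.
Proof.
apply/ffunP=> x; rewrite sum_ffunE (bigD1 x) //= big1 ?addr0 => [|y yx].
  by rewrite !ffunE eqxx /GRing.scale /= mulr1.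
by rewrite !ffunE eq_sym (negPf yx) /GRing.scale /= mulr0.
Qed.

Lemma bar_op_linear i : linear (bar_op i).
Proof.
move=> a v w; rewrite /bar_op scaler_sumr -big_split /=; apply: eq_bigr => t _.
by rewrite !ffunE scalerDl scalerA.
Qed.
HB.instance Definition _ i := GRing.isLinear.Build F V V _ (bar_op i)
  (@bar_op_linear i).

Lemma bar_op_basisv i t : bar_op i (basisv t) = bar_basis i t.
Proof.
rewrite /bar_op (bigD1 t) //= big1 ?addr0 => [|y yx].
  by rewrite ffunE eqxx scale1r.
by rewrite ffunE (negPf yx) scale0r.
Qed.

Lemma linear_basisv (f g : {linear V -> V}) :
  (forall t, f (basisv t) = g (basisv t)) -> f =1 g.
Proof.
move=> fg v; rewrite [v]basisv_expand !linear_sum; apply: eq_bigr => t _.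
by rewrite !linearZ /= fg.
Qed.

Lemma barH i t : (entry_row t (ent1 i) < entry_row t (ent0 i))%N ->
  bar_op i (basisv t) = - basisv t.
Proof. by move=> h; rewrite bar_op_basisv /bar_basis h. Qed.
Lemma bar0 i t : entry_row t (ent0 i) = entry_row t (ent1 i) ->
  bar_op i (basisv t) = 0.
Proof. by move=> h; rewrite bar_op_basisv /bar_basis h ltnn eqxx. Qed.
Lemma barL i t : (entry_row t (ent0 i) < entry_row t (ent1 i))%N ->
  bar_op i (basisv t) = basisv (swap i t).
Proof.
by move=> h; rewrite bar_op_basisv /bar_basis ltnNge ltnW //= ltn_eqF.
Qed.

Lemma barN i v : bar_op i (- v) = - bar_op i v.
Proof. exact: linearN. Qed.
Lemma barD i v w : bar_op i (v + w) = bar_op i v + bar_op i w.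
Proof. exact: linearD. Qed.
Lemma bar00 i : bar_op i 0 = 0.
Proof. exact: linear0. Qed.

Lemma bar_idem i v : bar_op i (bar_op i v) = - bar_op i v.
Proof.
move: v; pose f := bar_op i \o bar_op i; pose g := -%R \o bar_op i.
apply: (@linear_basisv f g) => t; rewrite /f /g /=.
case: (ltngtP (entry_row t (ent0 i)) (entry_row t (ent1 i))) => h.
- rewrite barL // barH // !entry_row_swap //.
  by rewrite tpermL tpermR.
- by rewrite barH // linearN /= barH.
- by rewrite bar0 // linear0 oppr0.
Qed.

Lemma swap_row (i : 'I_n.-1) (t : X) (k : 'I_n) :
  (entry_row t (ent0 i) < entry_row t (ent1 i))%N ->
  (k != ent0 i) -> (k != ent1 i) -> entry_row (swap i t) k = entry_row t k.
Proof. by move=> h k0 k1; rewrite entry_row_swap // tpermD // eq_sym. Qed.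
Lemma swap_row0 (i : 'I_n.-1) (t : X) :
  (entry_row t (ent0 i) < entry_row t (ent1 i))%N ->
  entry_row (swap i t) (ent0 i) = entry_row t (ent1 i).
Proof. by move=> h; rewrite entry_row_swap // tpermL. Qed.
Lemma swap_row1 (i : 'I_n.-1) (t : X) :
  (entry_row t (ent0 i) < entry_row t (ent1 i))%N ->
  entry_row (swap i t) (ent1 i) = entry_row t (ent0 i).
Proof. by move=> h; rewrite entry_row_swap // tpermR. Qed.

Lemma bar_comm (i j : 'I_n.-1) : (i.+1 < j)%N ->
  forall v, bar_op i (bar_op j v) = bar_op j (bar_op i v).
Proof.
move=> ij; pose f := bar_op i \o bar_op j; pose g := bar_op j \o bar_op i.
apply: (@linear_basisv f g) => t; rewrite /f /g /=.
have [n00 n01 n10 n11] : [/\ ent0 j != ent0 i, ent0 j != ent1 i,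
  ent1 j != ent0 i & ent1 j != ent1 i] by rewrite -!val_eqE /=; split; lia.
have [m00 m01 m10 m11] : [/\ ent0 i != ent0 j, ent0 i != ent1 j,
  ent1 i != ent0 j & ent1 i != ent1 j] by rewrite -!val_eqE /=; split; lia.
have rj k : (entry_row t (ent0 i) < entry_row t (ent1 i))%N ->
    k \in [:: ent0 j; ent1 j] -> entry_row (swap i t) k = entry_row t k.
  by move=> h; rewrite !inE => /orP[]/eqP ->; apply: swap_row.
have ri k : (entry_row t (ent0 j) < entry_row t (ent1 j))%N ->
    k \in [:: ent0 i; ent1 i] -> entry_row (swap j t) k = entry_row t k.
  by move=> h; rewrite !inE => /orP[]/eqP ->; apply: swap_row.
have [e0i e1i] : ent0 i \in [:: ent0 i; ent1 i] /\ ent1 i \in [:: ent0 i; ent1 i].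
  by rewrite !inE !eqxx orbT.
have [e0j e1j] : ent0 j \in [:: ent0 j; ent1 j] /\ ent1 j \in [:: ent0 j; ent1 j].
  by rewrite !inE !eqxx orbT.
case: (ltngtP (entry_row t (ent0 i)) (entry_row t (ent1 i))) => hi;
case: (ltngtP (entry_row t (ent0 j)) (entry_row t (ent1 j))) => hj.
- rewrite (barL hi) (barL hj) !barL ?ri ?rj //; congr basisv.
  apply: val_inj; apply/ffunP => b.
  rewrite !swapE ?ri ?rj // !ffunE -![filling _]/(val _) !swapE // !ffunE.
  set k := filling t b.
  have [->|k0] := eqVneq k (ent0 i).
    rewrite tpermL (@tpermD _ (ent0 j) (ent1 j) (ent0 i)) //.
    by rewrite (@tpermD _ (ent0 j) (ent1 j) (ent1 i)) // tpermL.
  have [->|k1] := eqVneq k (ent1 i).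
    rewrite tpermR (@tpermD _ (ent0 j) (ent1 j) (ent1 i)) //.
    by rewrite (@tpermD _ (ent0 j) (ent1 j) (ent0 i)) // tpermR.
  rewrite (@tpermD _ (ent0 i) _ k) 1?eq_sym //.
  by rewrite tpermD //; case: tpermP => // _; rewrite eq_sym.
- by rewrite (barL hi) (barH hj) barN (barL hi) barH ?rj.
- by rewrite (barL hi) (bar0 hj) bar00 bar0 ?rj.
- by rewrite (barH hi) (barL hj) barN (barL hj) barH ?ri.
- by rewrite (barH hi) (barH hj) !barN (barH hi) (barH hj).
- by rewrite (barH hi) (bar0 hj) barN (bar0 hj) bar00 oppr0.
- by rewrite (bar0 hi) (barL hj) bar00 bar0 ?ri.
- by rewrite (bar0 hi) (barH hj) barN (bar0 hi) bar00 oppr0.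
- by rewrite (bar0 hi) (bar0 hj) !bar00.
Qed.

Lemma tperm_braid (T : finType) (a b c x : T) : a != b -> b != c -> a != c ->
  tperm a b (tperm b c (tperm a b x)) = tperm b c (tperm a b (tperm b c x)).
Proof.
move=> ab bc ac.
have abc : tperm a b c = c by rewrite tpermD.
have bca : tperm b c a = a by rewrite tpermD // eq_sym.
have [-> | xa] := eqVneq x a; first by rewrite !(tpermL, bca, abc).
have [-> | xb] := eqVneq x b; first by rewrite !(tpermL, tpermR, bca, abc).
have [-> | xc] := eqVneq x c; first by rewrite !(tpermR, bca, abc).
have abx : tperm a b x = x by rewrite tpermD // eq_sym.
have bcx : tperm b c x = x by rewrite tpermD // eq_sym.
by rewrite !(abx, bcx).
Qed.

Lemma bar_braid (i j : 'I_n.-1) : j = i.+1 :> nat ->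
  forall v, bar_op i (bar_op j (bar_op i v)) = bar_op j (bar_op i (bar_op j v)).
Proof.
move=> ij; pose f := bar_op i \o (bar_op j \o bar_op i).
pose g := bar_op j \o (bar_op i \o bar_op j).
apply: (@linear_basisv f g) => t; rewrite /f /g /=.
have e1 : ent0 j = ent1 i by apply: val_inj; rewrite /= ij.
have [n01 n12 n02] :
    [/\ ent0 i != ent1 i, ent1 i != ent1 j & ent0 i != ent1 j].
  by rewrite -!val_eqE /= ij; split; lia.
have H := barH; have Z := bar0; have L := barL.
have r0 u := @swap_row0 i u; have r1 u := @swap_row1 i u.
have s1 u := @swap_row0 j u; have s2 u := @swap_row1 j u.
have r2 (u : X) (h : (entry_row u (ent0 i) < entry_row u (ent1 i))%N) :
  entry_row (swap i u) (ent1 j) = entry_row u (ent1 j).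
  by apply: swap_row => //; rewrite eq_sym.
have s0 (u : X) (h : (entry_row u (ent1 i) < entry_row u (ent1 j))%N) :
  entry_row (swap j u) (ent0 i) = entry_row u (ent0 i).
  by apply: swap_row => //; rewrite e1.
have {}H u := H j u; have {}Z u := Z j u; have {}L u := L j u.
have Hi u := @barH i u; have Zi u := @bar0 i u; have Li u := @barL i u.
rewrite e1 in H Z L s1 s2.
have braid :
    (entry_row t (ent0 i) < entry_row t (ent1 i))%N ->
    (entry_row t (ent1 i) < entry_row t (ent1 j))%N ->
    swap i (swap j (swap i t)) = swap j (swap i (swap j t)).
  move=> h1 h2; have h3 := ltn_trans h1 h2.
  apply: val_inj; apply/ffunP => b.
  rewrite !swapE ?e1 ?(r0, r1, r2, s0, s1, s2) // !ffunE -![filling _]/(val _).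
  rewrite !swapE ?e1 ?(r0, r1, r2, s0, s1, s2) // !ffunE -![filling _]/(val _).
  rewrite !swapE ?e1 ?(r0, r1, r2, s0, s1, s2) // !ffunE.
  by rewrite ?e1; apply: tperm_braid.
case: (ltngtP (entry_row t (ent0 i)) (entry_row t (ent1 i))) => h01;
case: (ltngtP (entry_row t (ent1 i)) (entry_row t (ent1 j))) => h12.
- have h02 := ltn_trans h01 h12.
  have [[R0 R1] R2] := (r0 t h01, r1 t h01, r2 t h01).
  have [[S0 S1] S2] := (s0 t h12, s1 t h12, s2 t h12).
  have g1 : (entry_row (swap i t) (ent1 i) < entry_row (swap i t) (ent1 j))%N.
    by rewrite R1 R2.
  have g2 : (entry_row (swap j t) (ent0 i) < entry_row (swap j t) (ent1 i))%N.
    by rewrite S0 S1.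
  have g3 : (entry_row (swap j (swap i t)) (ent0 i)
             < entry_row (swap j (swap i t)) (ent1 i))%N.
    by rewrite (s0 _ g1) (s1 _ g1) R0 R2.
  have g4 : (entry_row (swap i (swap j t)) (ent1 i)
             < entry_row (swap i (swap j t)) (ent1 j))%N.
    by rewrite (r1 _ g2) (r2 _ g2) S0 S2.
  by rewrite (Li _ h01) (L _ h12) (L _ g1) (Li _ g2) (Li _ g3) (L _ g4) braid.
- have [[R0 R1] R2] := (r0 t h01, r1 t h01, r2 t h01).
  rewrite (Li _ h01) (H _ h12) barN (Li _ h01).
  case: (ltngtP (entry_row t (ent0 i)) (entry_row t (ent1 j))) => h02.
  + have g1 : (entry_row (swap i t) (ent1 i) < entry_row (swap i t) (ent1 j))%N.
      by rewrite R1 R2.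
    have g2 : (entry_row (swap j (swap i t)) (ent1 i)
               < entry_row (swap j (swap i t)) (ent0 i))%N.
      by rewrite (s0 _ g1) (s1 _ g1) R0 R2.
    by rewrite barN (L _ g1) (Hi _ g2).
  + have g1 : (entry_row (swap i t) (ent1 j) < entry_row (swap i t) (ent1 i))%N.
      by rewrite R1 R2.
    have g2 : (entry_row (swap i t) (ent1 i) < entry_row (swap i t) (ent0 i))%N.
      by rewrite R0 R1.
    by rewrite barN (H _ g1) barN (Hi _ g2).
  + have g1 : entry_row (swap i t) (ent1 i) = entry_row (swap i t) (ent1 j).
      by rewrite R1 R2.
    by rewrite barN (Z _ g1) bar00 oppr0.
- have [[R0 R1] R2] := (r0 t h01, r1 t h01, r2 t h01).
  have g1 : (entry_row (swap i t) (ent1 i) < entry_row (swap i t) (ent1 j))%N.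
    by rewrite R1 R2 -h12.
  have g2 : entry_row (swap j (swap i t)) (ent0 i)
            = entry_row (swap j (swap i t)) (ent1 i).
    by rewrite (s0 _ g1) (s1 _ g1) R0 R2.
  by rewrite (Li _ h01) (Z _ h12) !bar00 (L _ g1) (Zi _ g2).
- have [[S0 S1] S2] := (s0 t h12, s1 t h12, s2 t h12).
  rewrite (Hi _ h01) !barN (L _ h12).
  case: (ltngtP (entry_row t (ent0 i)) (entry_row t (ent1 j))) => h02.
  + have g1 : (entry_row (swap j t) (ent0 i) < entry_row (swap j t) (ent1 i))%N.
      by rewrite S0 S1.
    have g2 : (entry_row (swap i (swap j t)) (ent1 j)
               < entry_row (swap i (swap j t)) (ent1 i))%N.
      by rewrite (r1 _ g1) (r2 _ g1) S0 S2.
    by rewrite (Li _ g1) (H _ g2).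
  + have g1 : (entry_row (swap j t) (ent1 i) < entry_row (swap j t) (ent0 i))%N.
      by rewrite S0 S1.
    have g2 : (entry_row (swap j t) (ent1 j) < entry_row (swap j t) (ent1 i))%N.
      by rewrite S1 S2.
    by rewrite (Hi _ g1) barN (H _ g2).
  + have g1 : entry_row (swap j t) (ent0 i) = entry_row (swap j t) (ent1 i).
      by rewrite S0 S1.
    by rewrite (Zi _ g1) bar00 oppr0.
- by do 3!rewrite ?(Hi _ h01) ?(H _ h12) ?barN.
- by do 3!rewrite ?(Hi _ h01) ?(Z _ h12) ?barN ?bar00 ?oppr0.
- rewrite (Zi _ h01) !bar00 (L _ h12).
  have [[S0 S1] S2] := (s0 t h12, s1 t h12, s2 t h12).
  have g1 : (entry_row (swap j t) (ent0 i) < entry_row (swap j t) (ent1 i))%N.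
    by rewrite S0 S1 h01.
  have g2 : entry_row (swap i (swap j t)) (ent1 i)
            = entry_row (swap i (swap j t)) (ent1 j).
    by rewrite (r1 _ g1) (r2 _ g1) S0 S2.
  by rewrite (Li _ g1) (Z _ g2).
- by do 3!rewrite ?(Zi _ h01) ?(H _ h12) ?barN ?bar00 ?oppr0.
- by rewrite (Zi _ h01) (Z _ h12) !bar00.
Qed.

Lemma add_id_braid (W : zmodType) (f g : W -> W) :
  {morph f : v w / v + w} -> {morph g : v w / v + w} ->
  (forall v, f (f v) = - f v) -> (forall v, g (g v) = - g v) ->
  (forall v, f (g (f v)) = g (f (g v))) ->
  forall v, let f1 w := f w + w in let g1 w := g w + w in
  f1 (g1 (f1 v)) = g1 (f1 (g1 v)).
Proof.
move=> fD gD ff gg fgf v /=; rewrite !(fD, gD) fgf ff gg.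
rewrite !addrA (addrNK (f v)) (addrNK (g v)) -!addrA; congr (_ + _).
rewrite [RHS]addrCA; congr (_ + _).
by congr (_ + _); rewrite addrCA.
Qed.

Lemma P_op_linear i : linear (P_op i).
Proof. by move=> a v w; rewrite /P_op (bar_op_linear i) scalerDr addrACA. Qed.
Lemma P_op_idem i v : P_op i (P_op i v) = P_op i v.
Proof. by rewrite /P_op barD bar_idem addNr add0r. Qed.
Lemma P_op_comm (i j : 'I_n.-1) : (i.+1 < j)%N ->
  forall v, P_op i (P_op j v) = P_op j (P_op i v).
Proof.
move=> ij v; rewrite /P_op !barD (bar_comm ij).
move: (bar_op j (bar_op i v)) (bar_op i v) (bar_op j v) => z p q.
by apply/ffunP => k; rewrite !ffunE; ring.
Qed.
Lemma P_op_braid (i j : 'I_n.-1) : j = i.+1 :> nat ->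
  forall v, P_op i (P_op j (P_op i v)) = P_op j (P_op i (P_op j v)).
Proof.
move=> ij v; apply: add_id_braid.
- exact: barD.
- exact: barD.
- exact: bar_idem.
- exact: bar_idem.
- exact: bar_braid.
Qed.

Definition P_action : gen_action n V :=
  GenAction P_op_linear P_op_idem P_op_comm P_op_braid.

(* The module on the standard tableaux of shape d; it is P_gamma when         *)
(* d = gribbon gamma and gamma has size n.                                    *)
Definition tab_module := hmod P_action.

Lemma hpibarE (i : 'I_n.-1) (v : tab_module) : hpibar F i *: v = bar_op i v.
Proof. by rewrite scalerBl scale1r hpiE; apply: addrK. Qed.

End ModuleP.

Definition is_composition (n : nat) (a : seq nat) : bool :=
  (0%N \notin a) && (sumn a == n).

Record composition (n : nat) := Composition {
  parts :> seq nat;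
  partsP : is_composition n parts
}.

HB.instance Definition _ n := [isSub for @parts n].
HB.instance Definition _ n := [Countable of composition n by <:].

Fact mem_leq_sumn (s : seq nat) k : k \in s -> (k <= sumn s)%N.
Proof. by elim: s => //= a s IHs; rewrite inE => /predU1P[->|/IHs]; lia. Qed.

Fact composition_size n (a : composition n) : (size a <= n)%N.
Proof.
case: a => /= s /andP[s0 /eqP <-].
by elim: s s0 => //= k s IHs; rewrite inE negb_or => /andP[k0 /IHs]; lia.
Qed.

Fact composition_code_subproof n (a : composition n) :
  (size [seq (inord k : 'I_n.+1) | k <- a] <= n)%N.
Proof. by rewrite size_map composition_size. Qed.

Definition composition_code n (a : composition n) : n.-bseq 'I_n.+1 :=
  Bseq (composition_code_subproof a).
Definition composition_decode n (b : n.-bseq 'I_n.+1) : option (composition n) :=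
  insub [seq val k | k <- b].

Fact composition_codeK n : pcancel (@composition_code n) (@composition_decode n).
Proof.
move=> a; rewrite /composition_decode /composition_code /= -map_comp.
rewrite (eq_in_map _ id _).1 ?map_id ?valK // => k ka /=.
have /andP[_ /eqP sa] := partsP a.
by rewrite inordK // ltnS -sa mem_leq_sumn.
Qed.

HB.instance Definition _ n :=
  isFinite.Build (composition n) (pcan_enumP (@composition_codeK n)).

(* D(alpha)                                                                   *)
Definition descents (a : seq nat) : seq nat :=
  [seq sumn (take k a) | k <- iota 1 (size a).-1].

(* b \preccurlyeq a                                                           *)
Definition coarsens (b a : seq nat) : bool := all (mem (descents a)) (descents b).

Section Parabolic.
Variables (F : fieldType) (n : nat) (alpha : seq nat).
Local Notation H := (hecke0 F n).

(* The subalgebra generated by the pi_k with k not in D(alpha); recall that   *)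
(* [hpi F i] is pi_(i+1).                                                     *)
Inductive in_parabolic : H -> Prop :=
| para_scalar a : in_parabolic a%:A
| para_gen (i : 'I_n.-1) : i.+1 \notin descents alpha -> in_parabolic (hpi F i)
| para_add x y : in_parabolic x -> in_parabolic y -> in_parabolic (x + y)
| para_mul x y : in_parabolic x -> in_parabolic y -> in_parabolic (x * y).

Definition parabolic : {pred H} := fun x => `[< in_parabolic x >].

Fact parabolic_closed : GRing.subsemialg_closed parabolic.
Proof.
split.
- by apply/asboolP; rewrite -(scale1r 1); apply: para_scalar.
- split=> [|x y].
    by apply/asboolP; rewrite -(scale0r 1); apply: para_scalar.
  by move=> /asboolP px /asboolP py; apply/asboolP/para_add.
- move=> a x /asboolP px; apply/asboolP.
  by rewrite -[x]mul1r scalerAl; apply: para_mul => //; apply: para_scalar.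
- by move=> x y /asboolP px /asboolP py; apply/asboolP/para_mul.
Qed.

Record parahecke := Parahecke {
  para_val : H;
  para_valP : para_val \in parabolic
}.

HB.instance Definition _ := [isSub for para_val].
HB.instance Definition _ := [Choice of parahecke by <:].
HB.instance Definition _ := GRing.SubChoice_isSubAlgebra.Build F H parabolic
  parahecke parabolic_closed.

End Parabolic.

Definition para_res (F : fieldType) n (alpha : seq nat) (M : lmodType (hecke0 F n))
  : Type := M.

Section ParaRes.
Variables (F : fieldType) (n : nat) (alpha : seq nat) (M : lmodType (hecke0 F n)).
Local Notation N := (para_res alpha M).
Local Notation B := (parahecke F n alpha).

HB.instance Definition _ := GRing.Zmodule.copy N M.

Definition res_scale (b : B) (v : N) : N := val b *: (v : M).
Fact res_scaleA x y v : res_scale x (res_scale y v) = res_scale (x * y) v.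
Proof. exact: scalerA. Qed.
Fact res_scale1 : left_id 1 res_scale.
Proof. exact: scale1r. Qed.
Fact res_scaleDr : right_distributive res_scale +%R.
Proof. by move=> b v w; apply: scalerDr. Qed.
Fact res_scaleDl v : {morph res_scale^~ v : a b / a + b}.
Proof. by move=> a b; apply: scalerDl. Qed.

HB.instance Definition _ := GRing.Zmodule_isLmodule.Build B N
  res_scaleA res_scale1 res_scaleDr res_scaleDl.

End ParaRes.

Section OuterTensor.
Variables (F : fieldType) (n : nat) (alpha : seq nat).
Variable (X : 'I_(size alpha) -> finType).
Variable act : forall j : 'I_(size alpha),
  gen_action (nth 0%N alpha j) {ffun X j -> F^o}.

(* The tensor product of the spaces with bases X j is the space with basis    *)
(* the product of the X j, see [pure_tensor].                                 *)
Local Notation PX := {dffun forall j, X j}.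
Local Notation T := {ffun PX -> F^o}.
Local Notation V j := {ffun X j -> F^o}.

Definition pure_tensor (v : forall j, V j) : T :=
  [ffun x : PX => \prod_j v j (x j)].

Definition upd (x : PX) j (y : X j) : PX := [ffun k => dfwith x y k].

(* id (x) ... (x) f (x) ... (x) id, with f acting on the factor j; see        *)
(* [factor_op_pure].                                                          *)
Definition factor_op j (f : V j -> V j) (w : T) : T :=
  [ffun x : PX => f [ffun y => w (upd x y)] (x j)].

Lemma upd_in x j (y : X j) : upd x y j = y.
Proof. by rewrite ffunE dfwith_in. Qed.
Lemma upd_out x j (y : X j) k : j != k -> upd x y k = x k.
Proof. by move=> jk; rewrite ffunE dfwith_out. Qed.
Lemma upd_upd x j (y z : X j) : upd (upd x y) z = upd x z.
Proof.
apply/ffunP => k; have [<-|jk] := eqVneq j k; first by rewrite !upd_in.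
by rewrite !upd_out.
Qed.
Lemma updC x j k (y : X j) (z : X k) : j != k ->
  upd (upd x y) z = upd (upd x z) y.
Proof.
move=> jk; apply/ffunP => i; have [<-|ji] := eqVneq j i.
  by rewrite upd_out ?upd_in // eq_sym.
have [<-|ki] := eqVneq k i; first by rewrite upd_in upd_out ?upd_in.
by rewrite !upd_out.
Qed.

Lemma linear_sum_basis (Y : finType) (f : {ffun Y -> F^o} -> {ffun Y -> F^o})
    (v : {ffun Y -> F^o}) z : linear f ->
  f v z = \sum_y v y * f [ffun y' => (y' == y)%:R] z.
Proof.
move=> lf.
pose fl : {linear _ -> _} := HB.pack f (GRing.isLinear.Build F _ _ _ f lf).
rewrite -[f]/(fl : _ -> _).
rewrite {1}(_ : v = \sum_y v y *: [ffun y' => (y' == y)%:R]).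
  by rewrite linear_sum sum_ffunE; apply: eq_bigr => y _; rewrite linearZ ffunE.
apply/ffunP => x; rewrite sum_ffunE (bigD1 x) //= big1 ?addr0 => [|y yx].
  by rewrite !ffunE eqxx /GRing.scale /= mulr1.
by rewrite !ffunE eq_sym (negPf yx) /GRing.scale /= mulr0.
Qed.

Lemma factor_op_pure j (f : V j -> V j) v : linear f ->
  factor_op f (pure_tensor v) = pure_tensor (dfwith v (f (v j))).
Proof.
move=> lf; apply/ffunP => x; rewrite !ffunE !(linear_sum_basis _ _ lf).
rewrite (bigD1 j) //= dfwith_in (linear_sum_basis _ _ lf) mulr_suml.
apply: eq_bigr => y _; rewrite !ffunE (bigD1 j) //= upd_in mulrAC.
congr (_ * _ * _); apply: eq_bigr => k kj.
by rewrite upd_out ?dfwith_out // eq_sym.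
Qed.

Lemma factor_op_linear j (f : V j -> V j) : linear f -> linear (factor_op f).
Proof.
move=> lf a u w; apply/ffunP => x; rewrite !ffunE.
rewrite (_ : [ffun y => _] = a *: [ffun y => u (upd x y)]
                             + [ffun y => w (upd x y)]).
  by rewrite lf !ffunE.
by apply/ffunP => y; rewrite !ffunE.
Qed.

Lemma factor_op_comp j (f g : V j -> V j) w :
  factor_op f (factor_op g w) = factor_op (f \o g) w.
Proof.
apply/ffunP => x; rewrite !ffunE /=; congr (f _ _); apply/ffunP => y.
rewrite !ffunE dfwith_in; congr (g _ _); apply/ffunP => z.
by rewrite !ffunE upd_upd.
Qed.

Lemma eq_factor_op j (f g : V j -> V j) w :
  f =1 g -> factor_op f w = factor_op g w.
Proof. by move=> fg; apply/ffunP => x; rewrite !ffunE fg. Qed.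

Lemma factor_opC j k (f : V j -> V j) (g : V k -> V k) w :
  j != k -> linear f -> linear g ->
  factor_op f (factor_op g w) = factor_op g (factor_op f w).
Proof.
move=> jk lf lg; apply/ffunP => x.
rewrite !ffunE (linear_sum_basis _ _ lf) (linear_sum_basis _ _ lg).
pose fj y := f [ffun y' => (y' == y)%:R] (x j).
pose gk z := g [ffun z' => (z' == z)%:R] (x k).
transitivity (\sum_y \sum_z w (upd (upd x y) z) * gk z * fj y).
  apply: eq_bigr => y _; rewrite !ffunE (linear_sum_basis _ _ lg) mulr_suml.
  by apply: eq_bigr => z _; rewrite ffunE dfwith_out.
rewrite exchange_big; apply: eq_bigr => z _.
rewrite !ffunE (linear_sum_basis _ _ lf) mulr_suml.
apply: eq_bigr => y _; rewrite ffunE dfwith_out 1?eq_sym // updC // -!mulrA.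
by congr (_ * _); rewrite mulrC.
Qed.

(* The pair (j, k) stands for the generator pi_(k+1) of the j-th factor of    *)
(* H_(alpha_1)(0) (x) ... (x) H_(alpha_l)(0); it corresponds to the generator *)
(* of H_n(0) of index [block_pos (j, k)].                                     *)
Definition block_gen := {j : 'I_(size alpha) & 'I_(nth 0%N alpha j).-1}.
Definition block_pos (p : block_gen) : nat :=
  (sumn (take (tag p) alpha) + tagged p)%N.

(* Fallback case: i+1 is in D(alpha), so [hpi F i] is not a generator of      *)
(* H_alpha(0); its action is irrelevant to [outer_tensor], which forgets it,  *)
(* and the identity is compatible with the relations.                         *)
Definition outer_op (i : 'I_n.-1) (w : T) : T :=
  if [pick p : block_gen | block_pos p == i] is Some p
  then factor_op (act (tag p) (tagged p)) w
  else w.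

Lemma sumn_take_le j k : (j < k)%N -> (k <= size alpha)%N ->
  (sumn (take j alpha) + nth 0%N alpha j <= sumn (take k alpha))%N.
Proof.
elim: k => // k IHk; rewrite ltnS leq_eqVlt => /predU1P[->|jk] ks.
  by rewrite (take_nth 0%N) // sumn_rcons.
apply: leq_trans (IHk jk (ltnW ks)) _.
by rewrite (take_nth 0%N) // sumn_rcons leq_addr.
Qed.

Lemma block_pos_near (p q : block_gen) :
  (block_pos p <= block_pos q <= (block_pos p).+1)%N -> tag p = tag q.
Proof.
case: p q => [j k] [j' k'] /=; rewrite /block_pos /= => /andP[h1 h2].
have kj := ltn_ord k; have kj' := ltn_ord k'.
have sj := ltn_ord j; have sj' := ltn_ord j'.
apply: val_inj => /=; case: (ltngtP j j') => // jj.
- by have := sumn_take_le jj (ltnW sj'); lia.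
- by have := sumn_take_le jj (ltnW sj); lia.
Qed.

Lemma block_pos_inj : injective block_pos.
Proof.
move=> p q pq; have tq : tag p = tag q by apply: block_pos_near; lia.
case: p q tq pq => [j k] [j' k'] /= tq.
rewrite -{j'}tq in k' *; rewrite /block_pos /= => kk'.
by congr (Tagged _ _); apply: val_inj => /=; lia.
Qed.

Lemma outer_op_pos (p : block_gen) (i : 'I_n.-1) w : block_pos p = i ->
  outer_op i w = factor_op (act (tag p) (tagged p)) w.
Proof.
move=> pi; rewrite /outer_op; case: pickP => [q /eqP qi|/(_ p)]; last first.
  by rewrite pi eqxx.
by rewrite (@block_pos_inj q p) // pi.
Qed.

Variant outer_op_spec (i : 'I_n.-1) : (T -> T) -> Prop :=
| OuterBlock p of block_pos p = i :
    outer_op_spec i (factor_op (act (tag p) (tagged p)))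
| OuterId : outer_op_spec i id.

Lemma outer_opP i : outer_op_spec i (outer_op i).
Proof.
rewrite (_ : outer_op i = if [pick p : block_gen | block_pos p == i] is Some p
  then factor_op (act (tag p) (tagged p)) else id); last first.
  by apply/funext => w; rewrite /outer_op; case: pickP.
by case: pickP => [p /eqP|_]; constructor.
Qed.

Lemma outer_op_linear i : linear (outer_op i).
Proof.
case: outer_opP => // p _; apply: factor_op_linear; exact: hop_linear.
Qed.

Lemma outer_op_idem i w : outer_op i (outer_op i w) = outer_op i w.
Proof.
case: outer_opP => // p _; rewrite factor_op_comp.
by apply: eq_factor_op => v; apply: hop_idem.
Qed.

Lemma outer_op_comm (i j : 'I_n.-1) : (i.+1 < j)%N ->
  forall w, outer_op i (outer_op j w) = outer_op j (outer_op i w).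
Proof.
move=> ij w; case: outer_opP => // p pi; case: outer_opP => // q qj.
have [tpq|tpq] := eqVneq (tag p) (tag q); last first.
  by apply: factor_opC => //; apply: hop_linear.
case: p q pi qj tpq => [a k] [b l] + + /= ab; rewrite -{b}ab in l *.
rewrite /block_pos /= => pi qj; rewrite !factor_op_comp.
by apply: eq_factor_op => v; apply: hop_comm; lia.
Qed.

Lemma outer_op_braid (i j : 'I_n.-1) : j = i.+1 :> nat -> forall w,
  outer_op i (outer_op j (outer_op i w)) = outer_op j (outer_op i (outer_op j w)).
Proof.
move=> ij w.
have oi := outer_op_idem i; have oj := outer_op_idem j; move: oi oj.
case: outer_opP => [p pi|]; case: outer_opP => [q qj|] oi oj //=.
have tpq : tag p = tag q by apply: block_pos_near; lia.
case: p q pi qj tpq {oi oj} => [a k] [b l] + + /= ab; rewrite -{b}ab in l *.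
rewrite /block_pos /= => pi qj; rewrite !factor_op_comp.
by apply: eq_factor_op => v; apply: hop_braid; lia.
Qed.

Definition outer_action : gen_action n T :=
  GenAction outer_op_linear outer_op_idem outer_op_comm outer_op_braid.

(* The H_alpha(0)-module N_1 (x) ... (x) N_l, where N_j is the                *)
(* H_(alpha_j)(0)-module with basis X j.                                      *)
Definition outer_tensor := para_res alpha (hmod outer_action).

Lemma outer_tensorE (b : parahecke F n alpha) (p : block_gen) (i : 'I_n.-1)
    (v : forall j, V j) :
  val b = hpi F i -> block_pos p = i ->
  b *: (pure_tensor v : outer_tensor)
    = pure_tensor (dfwith v (act (tag p) (tagged p) (v (tag p)))).
Proof.
move=> bi pi; rewrite -[LHS]/(res_scale b _) /res_scale bi hpiE /=.
by rewrite (outer_op_pos _ pi) factor_op_pure //; apply: hop_linear.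
Qed.

Lemma block_posP (i : nat) : (i.+1 < sumn alpha)%N ->
  reflect (exists p, block_pos p = i) (i.+1 \notin descents alpha).
Proof.
move=> ialpha; apply: (iffP idP) => [iD|[p pi]]; last first.
  apply/mapP => -[k]; rewrite mem_iota => kl ik.
  move: pi; case: p => j r; rewrite /block_pos /= => pi.
  have sj := ltn_ord j; have rj := ltn_ord r.
  have [jk|kj] := ltnP j k.
    have := @sumn_take_le j k jk; lia.
  case: (ltngtP k j) kj => // [kj|kj] _; last by move: ik; rewrite kj; lia.
  have := @sumn_take_le k j kj; lia.
have ex : exists k, (i < sumn (take k alpha))%N.
  by exists (size alpha); rewrite take_size; lia.
case: (ex_minnP ex) => k ik kmin.
case: k ik kmin => [|k] ik kmin; first by rewrite take0 in ik.
have kl : (k < size alpha)%N.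
  rewrite ltnNge; apply/negP => kl.
  have : (i < sumn (take k alpha))%N by rewrite take_oversize //; lia.
  by move=> /kmin; rewrite ltnn.
have ki : (sumn (take k alpha) <= i)%N.
  by rewrite leqNgt; apply/negP => /kmin; rewrite ltnn.
have sk : sumn (take k.+1 alpha) = (sumn (take k alpha) + nth 0%N alpha k)%N.
  by rewrite (take_nth 0%N) // sumn_rcons.
have iN : i.+1 != sumn (take k.+1 alpha).
  apply: contra iD => /eqP ik1; apply/mapP; exists k.+1 => //.
  rewrite mem_iota /=; have [//|ks] := ltnP k.+1 (size alpha); first by lia.
  by move: ialpha; rewrite ik1 take_oversize // ltnn.
have rk : (i - sumn (take k alpha) < (nth 0%N alpha (Ordinal kl)).-1)%N.
  by move: iN; rewrite sk /=; lia.
exists (Tagged (fun j : 'I_(size alpha) => 'I_(nth 0%N alpha j).-1) (Ordinal rk)).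
by rewrite /block_pos /=; lia.
Qed.

End OuterTensor.

Section Induction.
Variables (B A : nzRingType) (phi : {rmorphism B -> A}) (N : lmodType B).

Inductive tterm : Type :=
| TPure of A & N
| TZero
| TOpp of tterm
| TAdd of tterm & tterm.

(* The smallest congruence satisfying the axioms of abelian groups, the       *)
(* biadditivity of a (x) v, and a b (x) v = a (x) b v for b in B.             *)
Inductive teq : tterm -> tterm -> Prop :=
| teq_refl t : teq t t
| teq_sym t u : teq t u -> teq u t
| teq_trans t u v : teq t u -> teq u v -> teq t v
| teq_opp t t' : teq t t' -> teq (TOpp t) (TOpp t')
| teq_add t t' u u' : teq t t' -> teq u u' -> teq (TAdd t u) (TAdd t' u')
| teq_addA t u v : teq (TAdd t (TAdd u v)) (TAdd (TAdd t u) v)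
| teq_addC t u : teq (TAdd t u) (TAdd u t)
| teq_add0 t : teq (TAdd TZero t) t
| teq_addN t : teq (TAdd (TOpp t) t) TZero
| teq_pureDl a a' v : teq (TPure (a + a') v) (TAdd (TPure a v) (TPure a' v))
| teq_pureDr a v v' : teq (TPure a (v + v')) (TAdd (TPure a v) (TPure a v'))
| teq_balanced a b v : teq (TPure (a * phi b) v) (TPure a (b *: v)).

HB.instance Definition _ := gen_eqMixin tterm.
HB.instance Definition _ := gen_choiceMixin tterm.

Definition teqb (t u : tterm) : bool := `[< teq t u >].

Lemma teqb_equiv : equiv_class_of teqb.
Proof.
split=> [t|t u|u t v].
- by apply/asboolP/teq_refl.
- by apply/asboolP/asboolP => /teq_sym.
- by move=> /asboolP tu /asboolP uv; apply/asboolP/(teq_trans tu uv).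
Qed.

Canonical teqb_rel := EquivRelPack teqb_equiv.

(* A (x)_B N                                                                  *)
Definition induced : Type := {eq_quot teqb_rel}.
Local Notation I := induced.

HB.instance Definition _ := EqQuotient.copy I {eq_quot teqb_rel}.
HB.instance Definition _ := Choice.copy I {eq_quot teqb_rel}.

Definition ind_term (t : tterm) : I := \pi_I t.

Lemma ind_termP t u : reflect (teq t u) (ind_term t == ind_term u).
Proof. by rewrite /ind_term eqmodE; apply: asboolP. Qed.

Lemma ind_term_eq t u : teq t u -> ind_term t = ind_term u.
Proof. by move=> /ind_termP/eqP. Qed.

Lemma teq_repr t : teq (repr (ind_term t)) t.
Proof. by apply/ind_termP; rewrite /ind_term reprK. Qed.

Lemma ind_ind (P : I -> Prop) : (forall t, P (ind_term t)) -> forall x, P x.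
Proof. by move=> Pt x; rewrite -[x]reprK; apply: Pt. Qed.

Definition ind_add (x y : I) : I := ind_term (TAdd (repr x) (repr y)).
Definition ind_opp (x : I) : I := ind_term (TOpp (repr x)).

Lemma ind_addE t u : ind_add (ind_term t) (ind_term u) = ind_term (TAdd t u).
Proof. by apply: ind_term_eq; apply: teq_add; apply: teq_repr. Qed.
Lemma ind_oppE t : ind_opp (ind_term t) = ind_term (TOpp t).
Proof. by apply: ind_term_eq; apply: teq_opp; apply: teq_repr. Qed.

Fact ind_addA : associative ind_add.
Proof.
elim/ind_ind=> t; elim/ind_ind=> u; elim/ind_ind=> v.
by rewrite !ind_addE; apply/ind_term_eq/teq_addA.
Qed.
Fact ind_addC : commutative ind_add.
Proof.
elim/ind_ind=> t; elim/ind_ind=> u.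
by rewrite !ind_addE; apply/ind_term_eq/teq_addC.
Qed.
Fact ind_add0 : left_id (ind_term TZero) ind_add.
Proof. by elim/ind_ind=> t; rewrite ind_addE; apply/ind_term_eq/teq_add0. Qed.
Fact ind_addN : left_inverse (ind_term TZero) ind_opp ind_add.
Proof.
by elim/ind_ind=> t; rewrite ind_oppE ind_addE; apply/ind_term_eq/teq_addN.
Qed.

HB.instance Definition _ :=
  GRing.isZmodule.Build I ind_addA ind_addC ind_add0 ind_addN.

Definition tens (a : A) (v : N) : I := ind_term (TPure a v).

Lemma tensDl a a' v : tens (a + a') v = tens a v + tens a' v.
Proof.
by rewrite -[RHS]/(ind_add _ _) ind_addE; apply/ind_term_eq/teq_pureDl.
Qed.
Lemma tensDr a v v' : tens a (v + v') = tens a v + tens a v'.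
Proof.
by rewrite -[RHS]/(ind_add _ _) ind_addE; apply/ind_term_eq/teq_pureDr.
Qed.
Lemma tens_balanced a b v : tens (a * phi b) v = tens a (b *: v).
Proof. exact/ind_term_eq/teq_balanced. Qed.

Fixpoint tscale (a : A) (t : tterm) : tterm :=
  match t with
  | TPure a' v => TPure (a * a') v
  | TZero => TZero
  | TOpp t => TOpp (tscale a t)
  | TAdd t u => TAdd (tscale a t) (tscale a u)
  end.

Lemma tscale_teq a t u : teq t u -> teq (tscale a t) (tscale a u).
Proof.
elim=> {t u} /=.
- by move=> t; apply: teq_refl.
- by move=> t u _; apply: teq_sym.
- by move=> t u v _ tu _ uv; apply: teq_trans tu uv.
- by move=> t t' _ IH; apply: teq_opp.
- by move=> t t' u u' _ IH _ IH'; apply: teq_add.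
- by move=> t u v; apply: teq_addA.
- by move=> t u; apply: teq_addC.
- by move=> t; apply: teq_add0.
- by move=> t; apply: teq_addN.
- by move=> b b' v; rewrite mulrDr; apply: teq_pureDl.
- by move=> b v v'; apply: teq_pureDr.
- by move=> a' b v; rewrite mulrA; apply: teq_balanced.
Qed.

Definition ind_scale (a : A) (x : I) : I := ind_term (tscale a (repr x)).

Lemma ind_scaleE a t : ind_scale a (ind_term t) = ind_term (tscale a t).
Proof. by apply/ind_term_eq/tscale_teq/teq_repr. Qed.

Fact ind_scaleA a b x : ind_scale a (ind_scale b x) = ind_scale (a * b) x.
Proof.
elim/ind_ind: x => t; rewrite !ind_scaleE; congr ind_term.
by elim: t => /= [a' v||t ->|t -> u ->] //; rewrite mulrA.
Qed.
Fact ind_scale1 : left_id 1 ind_scale.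
Proof.
elim/ind_ind=> t; rewrite !ind_scaleE; congr ind_term.
by elim: t => /= [a' v||t ->|t -> u ->] //; rewrite mul1r.
Qed.
Fact ind_scaleDr : right_distributive ind_scale +%R.
Proof.
move=> a; elim/ind_ind=> t; elim/ind_ind=> u.
by rewrite -[_ + ind_term u]/(ind_add _ _) ind_addE !ind_scaleE -ind_addE.
Qed.
Fact ind_scaleDl x : {morph ind_scale^~ x : a b / a + b}.
Proof.
move=> a b /=; elim/ind_ind: x => t; elim: t => [c v||t IHt|t IHt u IHu].
- by rewrite !ind_scaleE /= mulrDl; apply: tensDl.
- by rewrite !ind_scaleE /= -[ind_term TZero]/(0 : I) addr0.
- have opp c : ind_scale c (ind_term (TOpp t)) = - ind_scale c (ind_term t).
    by rewrite !ind_scaleE /= -ind_oppE.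
  by rewrite !opp IHt opprD.
- have add c : ind_scale c (ind_term (TAdd t u))
      = ind_scale c (ind_term t) + ind_scale c (ind_term u).
    by rewrite !ind_scaleE /= -ind_addE.
  by rewrite !add IHt IHu addrACA.
Qed.

HB.instance Definition _ := GRing.Zmodule_isLmodule.Build A I
  ind_scaleA ind_scale1 ind_scaleDr ind_scaleDl.

Lemma tensZ a b v : a *: tens b v = tens (a * b) v.
Proof. exact: ind_scaleE. Qed.

End Induction.

Definition direct_sum (R : nzRingType) (I : finType) (M : I -> lmodType R) : Type
  := {dffun forall i, M i}.

Section DirectSum.
Variables (R : nzRingType) (I : finType) (M : I -> lmodType R).
Local Notation S := (direct_sum M).

HB.instance Definition _ := Choice.copy S {dffun forall i, M i}.

Definition dsum_zero : S := [ffun i => 0 : M i].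
Definition dsum_opp (x : S) : S := [ffun i => - x i].
Definition dsum_add (x y : S) : S := [ffun i => x i + y i].
Definition dsum_scale (a : R) (x : S) : S := [ffun i => a *: x i].

Fact dsum_addA : associative dsum_add.
Proof. by move=> x y z; apply/ffunP => i; rewrite !ffunE addrA. Qed.
Fact dsum_addC : commutative dsum_add.
Proof. by move=> x y; apply/ffunP => i; rewrite !ffunE addrC. Qed.
Fact dsum_add0 : left_id dsum_zero dsum_add.
Proof. by move=> x; apply/ffunP => i; rewrite !ffunE add0r. Qed.
Fact dsum_addN : left_inverse dsum_zero dsum_opp dsum_add.
Proof. by move=> x; apply/ffunP => i; rewrite !ffunE addNr. Qed.
HB.instance Definition _ :=
  GRing.isZmodule.Build S dsum_addA dsum_addC dsum_add0 dsum_addN.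

Fact dsum_scaleA a b x : dsum_scale a (dsum_scale b x) = dsum_scale (a * b) x.
Proof. by apply/ffunP => i; rewrite !ffunE scalerA. Qed.
Fact dsum_scale1 : left_id 1 dsum_scale.
Proof. by move=> x; apply/ffunP => i; rewrite !ffunE scale1r. Qed.
Fact dsum_scaleDr : right_distributive dsum_scale +%R.
Proof. by move=> a x y; apply/ffunP => i; rewrite !ffunE scalerDr. Qed.
Fact dsum_scaleDl x : {morph dsum_scale^~ x : a b / a + b}.
Proof. by move=> a b; apply/ffunP => i; rewrite !ffunE scalerDl. Qed.
HB.instance Definition _ := GRing.Zmodule_isLmodule.Build R S
  dsum_scaleA dsum_scale1 dsum_scaleDr dsum_scaleDl.

End DirectSum.

Definition module_iso (R : nzRingType) (U V : lmodType R) : Prop :=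
  exists f : {linear U -> V}, bijective f.

Section Modules.
Variables (F : fieldType) (n : nat) (alpha : composition n).

Definition P_ribbon (beta : composition n) : lmodType (hecke0 F n) :=
  tab_module F n (gribbon [:: parts beta]).

Definition M_comp : lmodType (hecke0 F n) :=
  tab_module F n (gribbon [seq [:: m] | m <- alpha]).

(* P_(alpha_1) (x) ... (x) P_(alpha_l), with P_(alpha_j) the module of the    *)
(* one-row ribbon.                                                            *)
Definition P_rows : lmodType (parahecke F n alpha) :=
  outer_tensor n (fun j : 'I_(size alpha) =>
    P_action F (nth 0%N alpha j) (gribbon [:: [:: nth 0%N alpha j]])).

Definition P_rows_ind : lmodType (hecke0 F n) :=
  induced (val : {rmorphism parahecke F n alpha -> hecke0 F n}) P_rows.

Definition P_sum : lmodType (hecke0 F n) :=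
  direct_sum (fun b : {b : composition n | coarsens b alpha} => P_ribbon (val b)).

End Modules.

(* Main.v *)
(* Reading a tableau row by row from the bottom gives a permutation w. The    *)
(* tableaux of M_alpha are the w whose descent set is contained in D(alpha),  *)
(* and those of P_beta are the w whose descent set is exactly D(beta).        *)
(*                                                                            *)
(* First isomorphism: H (x)_(H_alpha) N, with N one-dimensional, is the       *)
(* universal module with a generator killed by every pibar_i, i not in        *)
(* D(alpha). The tableau e of M_alpha with identity reading word is such a    *)
(* generator, which gives a map to M_alpha. Conversely, given such a vector u *)
(* in a module W, a tableau s with i in a higher row than i+1 is sent to      *)
(* pibar_i f(s_i s), and Matsumoto's argument (commutation and braid          *)
(* relations) shows that f(s) does not depend on i; f is then H-linear.       *)
(*                                                                            *)
(* Second isomorphism: P_beta -> M_alpha sends t to the sum of all s whose    *)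
(* rows, merged as prescribed by beta, have the same contents as the rows of  *)
(* t. Among these s, the one with the reading word of t has strictly fewest   *)
(* inversions, so the sum of these maps is unitriangular.                     *)
Require Import Defs.
From HB Require Import structures.
From mathcomp Require Import all_boot all_order all_algebra.
From mathcomp Require Import perm zify boolp.

Set Implicit Arguments.
Unset Strict Implicit.
Unset Printing Implicit Defensive.

Import GRing.Theory.

(** * Descents and row positions of compositions *)

(** A standard tableau is encoded by its reading word. For disjoint rows any word increasing along
    the rows occurs ([row_tableau_of_word]); for a ribbon, any word whose descent set is exactly
    D(beta) ([ribbon_tableau_of_word]). Hence the tableaux of M_alpha match those of all P_beta with
    beta coarser than alpha, and it remains to find H-linear maps compatible with these bases.

    For the induced module this is a universal property: a vector killed by every pibar_i with i
    outside D(alpha) is the image of the sorted tableau under an H-linear map on M_alpha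
    ([row_lift_linear]). Its two nontrivial ingredients are [row_lift_desc], independence of the
    sorting path, and [row_lift_same], vanishing inside a row. The inverse map is built with
    [induced_lift].

    For the direct sum, [related_sum_linear] provides H-linear maps from P_beta to M_alpha, and
    [related_lt_inversions] makes their sum unitriangular for the number of inversions. Injectivity
    ([sum_to_M_eq0]) and surjectivity ([sum_to_M_basis]) follow by induction on that number. *)

Lemma descents_cons m a : descents (m :: a) =
  if a is [::] then [::] else m :: [seq (m + d)%N | d <- descents a].
Proof.
case: a => [//|b a]; rewrite /descents /= addn0; congr cons.
rewrite (iotaDl 1 1) -!map_comp; exact: eq_map.
Qed.

Lemma descents_bounds a d : 0 \notin a -> d \in descents a -> 0 < d < sumn a.
Proof.
elim: a d => // m a IHa d; rewrite inE negb_or => /andP[m0 a0].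
rewrite descents_cons; case: a => [|b a] // in IHa a0 *.
rewrite inE => /predU1P[->|/mapP[e /(IHa _ a0) + ->]] /=; last by rewrite /=; lia.
by move: a0; rewrite inE; lia.
Qed.

(** The row, from the bottom, of the p-th box in reading order, both counted from 0: box d opens a
    new row exactly when d is in D(a). *)
Definition row_at (a : seq nat) (p : nat) : nat :=
  count (mem (descents a)) (iota 1 p).

Lemma row_atS a p : row_at a p.+1 = row_at a p + (p.+1 \in descents a).
Proof.
by rewrite /row_at -(addn1 p) iotaD count_cat /= addn0 add1n addn1.
Qed.

Lemma row_at_leq a p : row_at a p <= p.
Proof. by rewrite -[leqRHS](size_iota 1 p) count_size. Qed.

Lemma leq_row_at a : {homo row_at a : p q / p <= q}.
Proof. by apply: homo_leq => [//|p q r|p]; [exact: leq_trans|rewrite row_atS leq_addr]. Qed.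

Lemma row_at_lt a p q : row_at a p < row_at a q -> p < q.
Proof. by apply: contraTT; rewrite -!leqNgt; apply: leq_row_at. Qed.

(** Between p and q the row in [b] rises only at places where the row in [a] rises; the two
    increments are compared without truncated subtraction. *)
Lemma row_at_coarsens b a p q : coarsens b a -> p <= q ->
  row_at b q + row_at a p <= row_at a q + row_at b p.
Proof.
move=> /allP ba /subnKC <-; elim: (q - p) => [|k IHk]; first by rewrite addn0 addnC.
rewrite addnS !row_atS.
have : (p + k).+1 \in descents b <= ((p + k).+1 \in descents a).
  by case: (boolP (_ \in descents b)) => // /ba /= ->.
lia.
Qed.

Lemma row_at_coarsens_lt b a p q : coarsens b a ->
  row_at b p < row_at b q -> row_at a p < row_at a q.
Proof.
by move=> ba pq; have := row_at_coarsens ba (ltnW (row_at_lt pq)); lia.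
Qed.

Lemma row_at_coarsens_eq b a p q : coarsens b a ->
  row_at a p = row_at a q -> row_at b p = row_at b q.
Proof.
move=> ba; case: ltngtP (row_at_coarsens_lt (p := p) (q := q) ba)
  (row_at_coarsens_lt (p := q) (q := p) ba) => // _.
- by move=> /(_ isT); lia.
- by move=> _ /(_ isT); lia.
Qed.

Lemma row_at_cons m a p : 0 < m -> 0 \notin a -> p < m + sumn a ->
  row_at (m :: a) p = if p < m then 0 else (row_at a (p - m)).+1.
Proof.
move=> m0 a0 pma.
have lo q : q \in descents (m :: a) -> m <= q.
  rewrite descents_cons; case: (a) => // b c.
  by rewrite inE => /predU1P[->//|/mapP[e _ ->]]; apply: leq_addr.
have cnt0 q : q < m -> row_at (m :: a) q = 0.
  move=> qm; apply/eqP; rewrite eqn0Ngt -has_count -all_predC; apply/allP => r /=.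
  by rewrite mem_iota => rq; apply/negP => /lo; lia.
case: ltnP => [/cnt0 //|mp].
case: a => [|b a] /= in a0 pma lo cnt0 *; first by lia.
rewrite -{1}(subnKC mp); elim: (p - m) => [|k IHk].
  rewrite addn0 -{2}(prednK m0) row_atS cnt0 ?prednK //.
  by rewrite descents_cons inE eqxx.
rewrite addnS !row_atS IHk addSn; congr (_ + _).+1.
rewrite descents_cons inE -addnS mem_map; last exact: addnI.
by rewrite -[X in _ == X]addn0 eqn_add2l.
Qed.

Lemma rows_boxesE r c a : 0 \notin a ->
  gribbon_boxes r c [seq [:: m] | m <- a]
  = [seq (r + row_at a p, c + p) | p <- iota 0 (sumn a)].
Proof.
elim: a r c => //= m a IHa r c; rewrite inE negb_or eq_sym -lt0n => /andP[m0 a0].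
rewrite cats0 addn0 subn0 iotaD map_cat IHa // addn1; congr cat.
  rewrite /row_boxes; apply/eq_in_map => p; rewrite mem_iota => pm.
  by rewrite row_at_cons // ?addn0; last lia; case: ltnP => //; [rewrite addn0|lia].
rewrite add0n (_ : iota m _ = [seq m + p | p <- iota 0 (sumn a)]).
  2: by rewrite -iotaDl addn0.
rewrite -map_comp; apply/eq_in_map => p; rewrite mem_iota => pm /=.
rewrite row_at_cons //; last lia.
rewrite ltnNge leq_addr /= addKn; congr pair; lia.
Qed.

(** Each row starts in the column where the row below ends, so the column lags behind the reading
    position by one for every row passed. *)
Lemma ribbon_boxesE r c a : 0 \notin a ->
  ribbon_boxes r c a
  = [seq (r + row_at a p, c + p - row_at a p) | p <- iota 0 (sumn a)].
Proof.
elim: a r c => //= m a IHa r c; rewrite inE negb_or eq_sym -lt0n => /andP[m0 a0].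
rewrite iotaD map_cat IHa //; congr cat.
  rewrite /row_boxes; apply/eq_in_map => p; rewrite mem_iota => pm.
  rewrite row_at_cons //; last lia.
  by case: ltnP => //; [rewrite addn0 subn0|lia].
rewrite add0n (_ : iota m _ = [seq m + p | p <- iota 0 (sumn a)]).
  2: by rewrite -iotaDl addn0.
rewrite -map_comp; apply/eq_in_map => p; rewrite mem_iota => pm /=.
rewrite row_at_cons //; last lia.
rewrite ltnNge leq_addr /= addKn; have le_p := row_at_leq a p; congr pair; lia.
Qed.

(** Induction on n, adding a box in front: it forms a row of its own if 1 is in [D], and lengthens
    the first row otherwise. *)
Lemma composition_of_descents n (D : pred nat) :
  exists a : composition n, forall d, (d \in descents a) = (0 < d < n) && D d.
Proof.
suff [a a0 [an aD]] : exists2 a, 0 \notin a &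
    sumn a = n /\ forall d, (d \in descents a) = (0 < d < n) && D d.
  have aP : is_composition n a by rewrite /is_composition a0 an eqxx.
  by exists (Composition aP).
elim: n D => [|n IHn] D; first by exists [::] => //; split=> // -[].
case: n IHn => [|n] IHn; first by exists [:: 1] => //; split=> // -[|[]].
have [[|m a] a0 [an aD]] := IHn (fun d => D d.+1); first by [].
have m0 : 0 < m by move: a0; rewrite inE; lia.
have descS : descents (m.+1 :: a) = [seq d.+1 | d <- descents (m :: a)].
  rewrite !descents_cons; case: (a) => // b c /=; congr cons.
  by rewrite -map_comp; apply: eq_map => d /=; rewrite addSn.
case D1: (D 1).
  exists [:: 1, m & a]; first by move: a0; rewrite !inE.
  split; first by rewrite -an.
  move=> d; rewrite descents_cons inE; case: d => [|d].
    by apply/negbTE/mapP => -[].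
  rewrite mem_map; last exact: addnI.
  by rewrite aD; case: d => [|d]; [rewrite D1|].
exists (m.+1 :: a); first by move: a0; rewrite !inE !negb_or => /andP[_ ->].
split; first by rewrite -an.
move=> d; rewrite descS; case: d => [|d]; first by apply/negbTE/mapP => -[].
by rewrite mem_map ?aD; [case: d => [|d]; rewrite ?D1|exact: succn_inj].
Qed.

(** The first part is the least descent, and is the whole size if there is none; removing it shifts
    the other descents. *)
Lemma descents_inj n (a b : composition n) :
  descents a =i descents b -> a = b.
Proof.
case: a b => a aP [b bP] /= ab; apply: val_inj => /=.
have [/andP[a0 /eqP an] /andP[b0 /eqP bn]] := (aP, bP).
move: an; rewrite -bn => {n aP bP bn}.
elim: a b a0 b0 ab => [|m a IHa] [|k b] //=.
- by rewrite inE; lia.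
- by rewrite inE; lia.
rewrite !inE !negb_or => /andP[m0 a0] /andP[k0 b0] ab.
have lo x c q : q \in descents (x :: c) -> x <= q.
  rewrite descents_cons; case: (c) => // z c'.
  by rewrite inE => /predU1P[->//|/mapP[e _ ->]]; apply: leq_addr.
have hd x z c : x \in descents [:: x, z & c] by rewrite descents_cons inE eqxx.
case: a b => [|x a] [|y b] in IHa a0 b0 ab *.
- by rewrite /= !addn0 => ->.
- by have := ab k; rewrite hd.
- by have := ab m; rewrite hd.
have mk : m = k.
  apply/eqP; rewrite eqn_leq (lo m (x :: a)) ?ab ?hd //.
  by rewrite (lo k (y :: b)) // -ab hd.
move: ab; rewrite -{k}mk in k0 * => ab /addnI sab; congr cons.
apply: IHa => // d; have := ab (m + d).
rewrite !(descents_cons m) !inE !mem_map; try exact: addnI.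
case: d => [|d]; last by rewrite -[X in _ == X]addn0 eqn_add2l.
by move=> _; apply/idP/idP => [/(descents_bounds a0)|/(descents_bounds b0)].
Qed.

(** * Reading words of standard tableaux *)

Section Reading.
Variables (n : nat) (d : seq box) (b : nat -> box).
Hypotheses (dE : d = mkseq b n) (b_inj : injective b).

Fact box_at_subproof (p : 'I_n) : b p \in d.
Proof. by rewrite dE map_f // mem_iota /=. Qed.
Definition box_at (p : 'I_n) : seq_sub d := SeqSub (box_at_subproof p).

Lemma box_at_bij : bijective box_at.
Proof.
apply: inj_card_bij => [p q /(congr1 val)/b_inj/val_inj //|].
by rewrite card_seq_sub ?card_ord dE ?size_mkseq // mkseq_uniq.
Qed.

Fact word_subproof (t : tableau n d) : injective (fun p => t (box_at p)).
Proof. by move=> p q /tab_inj /(bij_inj box_at_bij). Qed.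
Definition word (t : tableau n d) : {perm 'I_n} := perm (@word_subproof t).
Definition pos (t : tableau n d) : {perm 'I_n} := (word t)^-1%g.

Lemma wordE t p : word t p = t (box_at p).
Proof. by rewrite permE. Qed.

Lemma word_inj : injective word.
Proof.
have [g gK Kg] := box_at_bij => t u tu; apply: val_inj; apply/ffunP => x /=.
by rewrite -(Kg x) -!wordE tu.
Qed.

Lemma entry_row_pos t k : entry_row t k = brow (b (pos t k)).
Proof. by rewrite -{1}(permKV (word t) k) wordE entry_rowE. Qed.

Lemma word_row t (p q : 'I_n) : brow (b p) = brow (b q) ->
  bcol (b p) < bcol (b q) -> word t p < word t q.
Proof.
move=> r c; rewrite !wordE; have /and4P[_ _ /'forall_forallP rows _] := fillingP t.
by have := rows (box_at p) (box_at q); rewrite /= r eqxx c.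
Qed.

Lemma word_col t (p q : 'I_n) : bcol (b p) = bcol (b q) ->
  brow (b q) < brow (b p) -> word t p < word t q.
Proof.
move=> c r; rewrite !wordE; have /and4P[_ _ _ /'forall_forallP cols] := fillingP t.
by have := cols (box_at p) (box_at q); rewrite /= c eqxx r.
Qed.

Lemma standard_of_word (w : {perm 'I_n}) (f : {ffun seq_sub d -> 'I_n}) :
  (forall p, f (box_at p) = w p) ->
  (forall p q : 'I_n, brow (b p) = brow (b q) -> bcol (b p) < bcol (b q) ->
    w p < w q) ->
  (forall p q : 'I_n, bcol (b p) = bcol (b q) -> brow (b q) < brow (b p) ->
    w p < w q) ->
  is_standard f.
Proof.
have [g gK Kg] := box_at_bij => fw rows cols.
have fg x : f x = w (g x) by rewrite -fw Kg.
have bg x : val x = b (g x) by rewrite -{1}(Kg x).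
apply/and4P; split.
- by apply/injectiveP => x y; rewrite !fg => /perm_inj /(can_inj Kg).
- by apply/forallP => k; apply/codomP; exists (box_at (w^-1%g k)); rewrite fw permKV.
- apply/'forall_forallP => x y; apply/implyP => /andP[/eqP r c].
  by rewrite !fg rows -?bg.
- apply/'forall_forallP => x y; apply/implyP => /andP[/eqP c r].
  by rewrite !fg cols -?bg.
Qed.

Lemma tableau_of_word (w : {perm 'I_n}) :
  (forall p q : 'I_n, brow (b p) = brow (b q) -> bcol (b p) < bcol (b q) ->
    w p < w q) ->
  (forall p q : 'I_n, bcol (b p) = bcol (b q) -> brow (b q) < brow (b p) ->
    w p < w q) ->
  exists t, word t = w.
Proof.
have [g gK Kg] := box_at_bij => rows cols.
pose f : {ffun seq_sub d -> 'I_n} := [ffun x => w (g x)].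
have fw p : f (box_at p) = w p by rewrite ffunE gK.
exists (Tableau (standard_of_word fw rows cols)).
by apply/permP => p; rewrite wordE fw.
Qed.

End Reading.

(** * Reading words for disjoint rows and for ribbons *)

Section Shapes.
Variables (n : nat) (a : composition n).

Definition row_shape : seq box := gribbon [seq [:: m] | m <- a].
Definition ribbon_shape : seq box := gribbon [:: parts a].
Definition row_box (p : nat) : box := (row_at a p, p).
Definition ribbon_box (p : nat) : box := (row_at a p, p - row_at a p).

Fact row_shapeE : row_shape = mkseq row_box n.
Proof.
have /andP[a0 /eqP an] := partsP a.
by rewrite /row_shape /gribbon rows_boxesE // an.
Qed.

Fact ribbon_shapeE : ribbon_shape = mkseq ribbon_box n.
Proof.
have /andP[a0 /eqP an] := partsP a.
by rewrite /ribbon_shape /gribbon /= cats0 ribbon_boxesE // an.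
Qed.

Fact row_box_inj : injective row_box.
Proof. by move=> p q []. Qed.

Fact ribbon_box_inj : injective ribbon_box.
Proof.
by move=> p q []; have := row_at_leq a p; have := row_at_leq a q; lia.
Qed.

Definition row_word := word row_shapeE row_box_inj.
Definition row_pos := pos row_shapeE row_box_inj.
Definition ribbon_word := word ribbon_shapeE ribbon_box_inj.
Definition ribbon_pos := pos ribbon_shapeE ribbon_box_inj.

Lemma row_entry_row (t : tableau n row_shape) k :
  entry_row t k = row_at a (row_pos t k).
Proof. exact: (entry_row_pos row_shapeE row_box_inj). Qed.

Lemma ribbon_entry_row (t : tableau n ribbon_shape) k :
  entry_row t k = row_at a (ribbon_pos t k).
Proof. exact: (entry_row_pos ribbon_shapeE ribbon_box_inj). Qed.

Definition increasing_in_rows (w : {perm 'I_n}) :=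
  forall p q : 'I_n, row_at a p = row_at a q -> p < q -> w p < w q.

Lemma row_word_incr t : increasing_in_rows (row_word t).
Proof. by move=> p q pq lt_pq; apply: word_row. Qed.

(** Disjoint rows share no column, so the column condition is vacuous. *)
Lemma row_tableau_of_word w : increasing_in_rows w -> exists t, row_word t = w.
Proof.
move=> incr; apply: tableau_of_word => p q; first exact: incr.
by rewrite /brow /bcol /= => ->; rewrite ltnn.
Qed.

Lemma ribbon_word_incr t : increasing_in_rows (ribbon_word t).
Proof.
move=> p q pq lt_pq; apply: word_row => //; rewrite /bcol /= pq.
have := row_at_leq a p; lia.
Qed.

Lemma ribbon_word_desc t (p q : 'I_n) : q = p.+1 :> nat ->
  (ribbon_word t q < ribbon_word t p) = (p.+1 \in descents a).
Proof.
move=> qp; have := row_atS a p; have := row_at_leq a p; rewrite -qp => rp.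
case: (boolP (nat_of_ord q \in _)) => _ rq.
  by apply: word_col; rewrite /brow /bcol /=; lia.
by apply/negbTE; rewrite -leqNgt ltnW //; apply: ribbon_word_incr; lia.
Qed.

(** Consecutive boxes suffice: steps within a row are ascents, and two boxes of one column are
    joined by upward steps only, all descents. *)
Lemma ribbon_tableau_of_word (w : {perm 'I_n}) :
  (forall p q : 'I_n, q = p.+1 :> nat -> (w q < w p) = (p.+1 \in descents a)) ->
  exists t, ribbon_word t = w.
Proof.
move=> des; apply: tableau_of_word => p q.
  rewrite /brow /bcol /= => r c.
  have {c} [k qk] : exists k, q = (p + k.+1) :> nat.
    by exists (q - p).-1; lia.
  elim: k q qk r => [|k IHk] q qk r.
    rewrite addn1 in qk; have := des p q qk; have := row_atS a p; rewrite -qk r.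
    case: (_ \in _) => [|_ /negbT]; first by lia.
    rewrite -leqNgt leq_eqVlt => /predU1P[/val_inj/perm_inj pq|//].
    by move: qk; rewrite pq; lia.
  have lt_q' : p + k.+1 < n by have := ltn_ord q; lia.
  pose q' := Ordinal lt_q'.
  have qq' : q = q'.+1 :> nat by rewrite /=; lia.
  have le1 := @leq_row_at a p q'; have le2 := @leq_row_at a q' q.
  have r' : row_at a p = row_at a q' by rewrite /= in le1 le2 *; lia.
  apply: ltn_trans (IHk q' erefl r') _.
  have := des q' q qq'; have := row_atS a q'; rewrite -qq' -r' r.
  case: (_ \in _) => [|_ /negbT]; first by lia.
  rewrite -leqNgt leq_eqVlt => /predU1P[/val_inj/perm_inj pq|//].
  by move: qq'; rewrite pq; lia.
rewrite /brow /bcol /= => c r; have qp := row_at_lt r.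
have {qp} [k pk] : exists k, p = (q + k.+1) :> nat by exists (p - q).-1; lia.
elim: k p pk c r => [|k IHk] p pk c r.
  rewrite addn1 in pk; rewrite des //.
  have := row_atS a q; rewrite -pk; case: (_ \in _) => //; lia.
have lt_p' : q + k.+1 < n by have := ltn_ord p; lia.
pose p' := Ordinal lt_p'.
have pp' : p = p'.+1 :> nat by rewrite /=; lia.
(* Rows rise by at most one per step, so equal columns force a rise at every step between the two
   boxes. *)
have grow m : row_at a (q + m) <= row_at a q + m.
  elim: m => [|m]; first by rewrite !addn0.
  by rewrite !addnS row_atS; case: (_ \in _); lia.
have := row_at_leq a p; have := row_at_leq a q; have := row_at_leq a p'.
have := row_atS a p'; rewrite -pp'; have := grow k.+1; have := grow 1.
have := des p' p pp'; rewrite -pp'; case: (_ \in _) => wpp' g1 gk e l1 l2 l3.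
  by apply: ltn_trans (IHk p' erefl _ _) => //=; rewrite /= in e l1 gk *; lia.
by exfalso; rewrite /= in e l1 gk *; lia.
Qed.

End Shapes.

(** * Exchanging entries of a tableau of M_alpha *)

(** [swap] returns t when the exchange is not standard; a standard u with the exchanged word
    excludes this fallback. *)
Lemma swap_eq n d b (dE : d = mkseq b n) (b_inj : injective b) i
    (t u : tableau n d) :
  word dE b_inj u = (word dE b_inj t * tperm (ent0 i) (ent1 i))%g -> swap i t = u.
Proof.
have [g gK Kg] := box_at_bij dE b_inj => uw.
rewrite /swap (_ : swap_filling i t = val u) ?valKd //.
apply/ffunP => x; rewrite ffunE -(Kg x) /= -!(wordE dE b_inj).
by rewrite uw permM.
Qed.

Lemma perm_homo_id n (p : {perm 'I_n}) :
  {homo p : k l / (k < l)%N} -> forall k, p k = k.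
Proof.
move=> p_homo; have p_ge m (k : 'I_n) : k = m :> nat -> m <= p k.
  elim: m k => // m IHm k km.
  have lt_m : m < n by have := ltn_ord k; lia.
  apply: leq_ltn_trans (IHm (Ordinal lt_m) erefl) _.
  by apply: p_homo; rewrite /= km.
have p_le m (k : 'I_n) : (k + m).+1 = n -> p k <= k.
  elim: m k => [|m IHm] k km; first by have := ltn_ord (p k); lia.
  have lt_k : k.+1 < n by lia.
  rewrite -ltnS; apply: leq_trans (IHm (Ordinal lt_k) _); last by rewrite /=; lia.
  exact: p_homo.
move=> k; apply/val_inj/eqP; rewrite eqn_leq (p_ge k) // (p_le (n - k.+1)) //.
by have := ltn_ord k; lia.
Qed.

Section RowSwap.
Variables (n : nat) (a : composition n).
Local Notation tab := (tableau n (row_shape a)).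
Implicit Types (t : tab) (i j : 'I_n.-1).

(** For disjoint rows the exchange is standard whenever the two entries lie in different rows, in
    either order; [swapE] covers one order only. *)
Lemma row_word_swap i t : entry_row t (ent0 i) != entry_row t (ent1 i) ->
  row_word (swap i t) = (row_word t * tperm (ent0 i) (ent1 i))%g.
Proof.
move=> neq_row.
have [|u uw] := @row_tableau_of_word n a (row_word t * tperm (ent0 i) (ent1 i))%g.
  move=> p q pq lt_pq; rewrite !permM; apply: tperm_mono.
    exact: row_word_incr.
  apply: contraR neq_row; rewrite negb_or !negbK => /andP[/eqP <- /eqP <-].
  by rewrite !row_entry_row /row_pos /pos !permK pq.
by rewrite (swap_eq uw).
Qed.

Lemma row_pos_swap i t k : entry_row t (ent0 i) != entry_row t (ent1 i) ->
  row_pos (swap i t) k = row_pos t (tperm (ent0 i) (ent1 i) k).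
Proof.
move=> /row_word_swap; rewrite /row_pos /pos -!/(row_word _) => ->.
by rewrite invgM tpermV permM.
Qed.

Lemma row_swap i t k : entry_row t (ent0 i) != entry_row t (ent1 i) ->
  entry_row (swap i t) k = entry_row t (tperm (ent0 i) (ent1 i) k).
Proof. by move=> neq_row; rewrite !row_entry_row row_pos_swap. Qed.

Lemma row_swap0 i t : entry_row t (ent0 i) != entry_row t (ent1 i) ->
  entry_row (swap i t) (ent0 i) = entry_row t (ent1 i).
Proof. by move=> neq_row; rewrite row_swap // tpermL. Qed.

Lemma row_swap1 i t : entry_row t (ent0 i) != entry_row t (ent1 i) ->
  entry_row (swap i t) (ent1 i) = entry_row t (ent0 i).
Proof. by move=> neq_row; rewrite row_swap // tpermR. Qed.

Lemma row_swapD i t k : entry_row t (ent0 i) != entry_row t (ent1 i) ->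
  k != ent0 i -> k != ent1 i -> entry_row (swap i t) k = entry_row t k.
Proof. by move=> neq_row k0 k1; rewrite row_swap // tpermD // eq_sym. Qed.

Lemma row_swapK i t : entry_row t (ent0 i) != entry_row t (ent1 i) ->
  swap i (swap i t) = t.
Proof.
move=> neq_row; apply: (@word_inj _ _ _ (row_shapeE a) (@row_box_inj n a)).
rewrite -!/(row_word _) row_word_swap; last by rewrite row_swap0 ?row_swap1 // eq_sym.
by rewrite row_word_swap // -mulgA tperm2 mulg1.
Qed.

(** Consecutive entries have increasing positions: otherwise they would share a row and stand there
    in the wrong order. An increasing permutation is the identity. *)
Lemma row_pos_id t :
  (forall i, entry_row t (ent0 i) <= entry_row t (ent1 i)) ->
  forall k, row_pos t k = k.
Proof.
move=> sorted; have pos_lt i : row_pos t (ent0 i) < row_pos t (ent1 i).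
  rewrite ltnNge; apply/negP => le_pos; have := sorted i.
  rewrite !row_entry_row leqNgt => /negP; apply.
  move: le_pos; rewrite leq_eqVlt => /predU1P[/val_inj/perm_inj/(congr1 val) /=|].
    by lia.
  move=> lt_pos; rewrite ltn_neqAle leq_row_at ?(ltnW lt_pos) // andbT.
  apply/eqP => rows; have := @row_word_incr n a t _ _ rows lt_pos.
  by rewrite /row_pos /pos !permKV /=; lia.
have pos_homo : {homo row_pos t : k l / k < l}.
  move=> k l kl; have [m lm] : exists m, l = (k + m.+1)%N :> nat.
    by exists (l - k).-1; lia.
  elim: m l lm {kl} => [|m IHm] l lm.
    have ik : k < n.-1 by have := ltn_ord l; lia.
    have := pos_lt (Ordinal ik).
    have -> : ent0 (Ordinal ik) = k by apply: val_inj.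
    by have -> : ent1 (Ordinal ik) = l by apply: val_inj; rewrite /= lm addn1.
  have il : k + m.+1 < n.-1 by have := ltn_ord l; lia.
  apply: ltn_trans (IHm (ent0 (Ordinal il)) erefl) _.
  by have -> : l = ent1 (Ordinal il) by apply: val_inj; rewrite /= lm; lia.
exact: perm_homo_id.
Qed.

Lemma row_reading_tableau : exists t, forall k, row_pos t k = k.
Proof.
have [|t tw] := @row_tableau_of_word n a 1%g.
  by move=> p q _; rewrite !perm1.
by exists t => k; rewrite /row_pos /pos -/(row_word t) tw invg1 perm1.
Qed.

(** The measure for sorting: smaller entries weigh more, so it drops when i, above i+1, is exchanged
    with it. *)
Definition row_weight t := \sum_(k < n) (n - k) * entry_row t k.

Lemma row_weight_swap i t : entry_row t (ent1 i) < entry_row t (ent0 i) ->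
  row_weight (swap i t) < row_weight t.
Proof.
move=> lt_row; have neq_row : entry_row t (ent0 i) != entry_row t (ent1 i) by lia.
have split2 (G : 'I_n -> nat) : \sum_k G k
    = G (ent0 i) + (G (ent1 i) + \sum_(k | (k != ent0 i) && (k != ent1 i)) G k).
  by rewrite (bigD1 (ent0 i)) //= (bigD1 (ent1 i)) //= -val_eqE /=; lia.
rewrite /row_weight !split2 row_swap0 // row_swap1 //.
rewrite (eq_bigr (fun k : 'I_n => (n - k) * entry_row t k)).
  have -> : n - ent0 i = (n - ent1 i).+1 by have := ltn_ord i; rewrite /=; lia.
  by rewrite !mulSn !addnA ltn_add2r; lia.
by move=> k /andP[k0 k1]; rewrite row_swapD.
Qed.

End RowSwap.

Local Open Scope ring_scope.

(** * Linear maps between H_n(0)-modules *)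

Section HeckeModules.
Variables (F : fieldType) (n : nat).
Local Notation H := (hecke0 F n).

Lemma hpibar_idem (i : 'I_n.-1) : hpibar F i * hpibar F i = - hpibar F i.
Proof.
by rewrite /hpibar mulrBl mul1r !mulrBr mulr1 hpi_idem subrr add0r.
Qed.

Lemma hpibar_comm (i j : 'I_n.-1) : (i.+1 < j)%N ->
  hpibar F i * hpibar F j = hpibar F j * hpibar F i.
Proof.
move=> ij; rewrite /hpibar mulrBl mul1r !mulrBr !mulr1 mulrBl mul1r hpi_comm //.
Qed.

Lemma hpibar_braid (i j : 'I_n.-1) : j = i.+1 :> nat ->
  hpibar F i * (hpibar F j * hpibar F i) = hpibar F j * (hpibar F i * hpibar F j).
Proof.
(* With f = -pi one has f f = -f and f + 1 = -pibar, so [add_id_braid] carries the braid relation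
   over, with the same sign on both sides. *)
move=> ij; pose f k (x : H) : H := - (hpi F k * x).
have fD k : {morph f k : x y / x + y} by move=> x y; rewrite /f mulrDr opprD.
have ff k x : f k (f k x) = - f k x by rewrite /f mulrN mulrA hpi_idem.
have fgf x : f i (f j (f i x)) = f j (f i (f j x)).
  by rewrite /f !mulrN !opprK !mulrA -[_ * _ * hpi F i]mulrA hpi_braid // !mulrA.
have := add_id_braid (fD i) (fD j) (ff i) (ff j) fgf 1.
have fE k x : f k x + x = - hpibar F k * x by rewrite /hpibar opprB mulrBl mul1r addrC.
by rewrite /= !fE !mulr1 !mulNr !mulrN !opprK => /oppr_inj.
Qed.

Lemma hscalarC (W : lmodType H) (h : H) (a : F) (w : W) :
  h *: (a%:A *: w) = a%:A *: (h *: w).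
Proof. by rewrite !scalerA mulr_algr mulr_algl. Qed.

(** H is generated by F and the pi_i = pibar_i + 1; induction on a term representing the scalar. *)
Lemma hecke_linear (U W : lmodType H) (g : U -> W) :
  {morph g : u v / u + v} ->
  (forall (a : F) u, g (a%:A *: u) = a%:A *: g u) ->
  (forall i u, g (hpibar F i *: u) = hpibar F i *: g u) ->
  linear g.
Proof.
move=> gD gZ gpi h u v; rewrite gD; congr (_ + _).
elim/hecke_ind: h => t; elim: t u => [a|i|t IHt t' IHt'|t IHt t' IHt'] u.
- have -> : hpi_term (HConst a) = a%:A :> H by apply/esym/hmul1r.
  exact: gZ.
- have hpi_scale (V : lmodType H) (w : V) : hpi F i *: w = hpibar F i *: w + w.
    by rewrite /hpibar scalerBl scale1r subrK.
  by rewrite -[hpi_term _]/(hpi F i) !hpi_scale gD gpi.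
- by rewrite -haddE -[hadd _ _]/(hpi_term t + hpi_term t') !scalerDl gD IHt IHt'.
- by rewrite -hmulE -[hmul _ _]/(hpi_term t * hpi_term t') -!scalerA IHt IHt'.
Qed.

Section Extension.
Variables (d : seq box) (W : lmodType H) (f : tableau n d -> W).

(** [W] carries only an H-action, so a scalar a of F acts on it as [a%:A]. *)
Definition tab_ext (v : tab_module F n d) : W :=
  \sum_t (((v : {ffun _ -> F^o}) t : F)%:A : H) *: f t.

Lemma tab_ext_basisv t : tab_ext (basisv F t) = f t.
Proof.
rewrite /tab_ext (bigD1 t) //= big1 => [|u ut].
  by rewrite ffunE eqxx scale1r scale1r addr0.
by rewrite ffunE (negPf ut) scale0r scale0r.
Qed.

Lemma tab_extD : {morph tab_ext : v w / v + w}.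
Proof.
move=> v w; rewrite /tab_ext -big_split; apply: eq_bigr => t _ /=.
by rewrite ffunE scalerDl scalerDl.
Qed.

Lemma tab_extZ (a : F) v : tab_ext (a%:A *: v) = a%:A *: tab_ext v.
Proof.
rewrite /tab_ext hscalarE scaler_sumr; apply: eq_bigr => t _.
by rewrite ffunE scalerA -scalerAl mul1r scalerA.
Qed.

Lemma tab_ext_linear :
  (forall i t, (entry_row t (ent1 i) < entry_row t (ent0 i))%N ->
    hpibar F i *: f t = - f t) ->
  (forall i t, entry_row t (ent0 i) = entry_row t (ent1 i) ->
    hpibar F i *: f t = 0) ->
  (forall i t, (entry_row t (ent0 i) < entry_row t (ent1 i))%N ->
    hpibar F i *: f t = f (swap i t)) ->
  linear tab_ext.
Proof.
move=> fH f0 fL; apply: hecke_linear; [exact: tab_extD|exact: tab_extZ|].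
have ext0 : tab_ext 0 = 0 by apply: (addIr (tab_ext 0)); rewrite -tab_extD !add0r.
have extN v : tab_ext (- v) = - tab_ext v.
  by apply/eqP; rewrite -subr_eq0 opprK -tab_extD addNr ext0.
move=> i v; rewrite hpibarE.
transitivity (\sum_t (((v : {ffun _ -> F^o}) t : F)%:A : H)
                     *: tab_ext (bar_basis F i t : tab_module F n d)).
  rewrite /bar_op (big_morph tab_ext tab_extD ext0); apply: eq_bigr => t _.
  by rewrite -tab_extZ hscalarE.
rewrite /tab_ext scaler_sumr; apply: eq_bigr => t _.
rewrite hscalarC -/(tab_ext _); congr (_ *: _); rewrite /bar_basis.
case: ltngtP => [lt_row|lt_row|eq_row]; last by rewrite ext0 f0.
- by rewrite extN tab_ext_basisv fH.
- by rewrite tab_ext_basisv fL.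
Qed.

End Extension.
Lemma tab_linear_ext d (W : lmodType H) (h h' : {linear tab_module F n d -> W}) :
  (forall t, h (basisv F t) = h' (basisv F t)) -> h =1 h'.
Proof.
move=> hh' v; rewrite [v]basisv_expand.
have sumE (f : tableau n d -> F^o) : \sum_t f t *: basisv F t
    = \sum_t ((f t : F)%:A : H) *: (basisv F t : tab_module F n d).
  by apply: eq_bigr => t _; rewrite hscalarE.
rewrite sumE !linear_sum; apply: eq_bigr => t _.
by rewrite !linearZ /= hh'.
Qed.

End HeckeModules.

(** * The universal property of M_alpha *)

Section RowLift.
Variables (F : fieldType) (n : nat) (a : composition n).
Variables (W : lmodType (hecke0 F n)) (u : W).
Hypothesis u_killed : forall i : 'I_n.-1, i.+1 \notin descents a ->
  hpibar F i *: u = 0.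
Local Notation tab := (tableau n (row_shape a)).
Local Notation desc i t := (entry_row t (ent1 i) < entry_row t (ent0 i))%N.
Implicit Types (t : tab) (i j : 'I_n.-1).

(** Sorting t: if i lies above i+1 then t = pibar_i (s_i t), which dictates the value, and a sorted
    tableau goes to u. The fuel [m] suffices once it exceeds [row_weight t]. *)
Fixpoint row_lift_rec (m : nat) t : W :=
  if m isn't m'.+1 then u else
  if [pick i | desc i t] is Some i then hpibar F i *: row_lift_rec m' (swap i t)
  else u.

Definition row_lift t : W := row_lift_rec (row_weight t).+1 t.

Lemma row_lift_recE m t : (row_weight t < m)%N -> row_lift_rec m t = row_lift t.
Proof.
suff lift_recE m1 m2 : (row_weight t < m1)%N -> (row_weight t < m2)%N ->
    row_lift_rec m1 t = row_lift_rec m2 t by move=> tm; apply: lift_recE.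
elim: m1 m2 t => // m1 IHm [|m2] t //= tm1 tm2.
case: pickP => // i /row_weight_swap lt_w; congr (_ *: _).
by apply: IHm; apply: leq_trans lt_w _.
Qed.

Lemma row_lift_ind (P : tab -> Prop) :
  (forall t, (forall v, (row_weight v < row_weight t)%N -> P v) -> P t) ->
  forall t, P t.
Proof.
move=> IH t; have [m] := ubnP (row_weight t).
elim: m t => // m IHm t tm; apply: IH => v lt_v.
by apply: IHm; apply: leq_trans lt_v _.
Qed.

Variant row_lift_spec t : W -> Prop :=
| RowLiftSwap i of desc i t : row_lift_spec t (hpibar F i *: row_lift (swap i t))
| RowLiftSorted of (forall i, entry_row t (ent0 i) <= entry_row t (ent1 i))%N :
    row_lift_spec t u.

Lemma row_liftP t : row_lift_spec t (row_lift t).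
Proof.
rewrite /row_lift /=; case: pickP => [i di|nd].
  by rewrite row_lift_recE ?row_weight_swap //; constructor.
by constructor=> i; rewrite leqNgt nd.
Qed.

Lemma desc_neq i t : desc i t -> entry_row t (ent0 i) != entry_row t (ent1 i).
Proof. by rewrite neq_ltn orbC => ->. Qed.

Lemma swap_comm i j t : (i.+1 < j)%N ->
  entry_row t (ent0 i) != entry_row t (ent1 i) ->
  entry_row t (ent0 j) != entry_row t (ent1 j) ->
  swap i (swap j t) = swap j (swap i t).
Proof.
move=> ij ni nj.
have [n00 n01 n10 n11] : [/\ ent0 j != ent0 i, ent0 j != ent1 i,
  ent1 j != ent0 i & ent1 j != ent1 i] by rewrite -!val_eqE /=; split; lia.
apply: (@word_inj _ _ _ (row_shapeE a) (@row_box_inj n a)).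
rewrite -!/(row_word _) !row_word_swap ?row_swapD // 1?eq_sym //.
by rewrite -!mulgA [X in (_ * X)%g]conjgC tpermJ !tpermD // eq_sym.
Qed.

Section Adjacent.
Variables (i j : 'I_n.-1).
Hypothesis ij : j = i.+1 :> nat.

Lemma ent0_next : ent0 j = ent1 i.
Proof. by apply: val_inj; rewrite /= ij. Qed.

Lemma ent_adjacent :
  [/\ ent0 i != ent1 i, ent1 i != ent1 j & ent0 i != ent1 j].
Proof. by rewrite -!val_eqE /= ij; split; lia. Qed.

Lemma adjacent_swap_low t : entry_row t (ent0 i) != entry_row t (ent1 i) ->
  [/\ entry_row (swap i t) (ent0 i) = entry_row t (ent1 i),
      entry_row (swap i t) (ent1 i) = entry_row t (ent0 i) &
      entry_row (swap i t) (ent1 j) = entry_row t (ent1 j)].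
Proof.
have [_ n12 n02] := ent_adjacent.
by move=> neq; rewrite row_swap0 // row_swap1 // row_swapD // eq_sym.
Qed.

Lemma adjacent_swap_high t : entry_row t (ent1 i) != entry_row t (ent1 j) ->
  [/\ entry_row (swap j t) (ent0 i) = entry_row t (ent0 i),
      entry_row (swap j t) (ent1 i) = entry_row t (ent1 j) &
      entry_row (swap j t) (ent1 j) = entry_row t (ent1 i)].
Proof.
rewrite -ent0_next; have [n01 _ n02] := ent_adjacent.
by move=> neq; rewrite row_swap0 // row_swap1 // row_swapD // ent0_next.
Qed.

Lemma swap_braid t :
  (entry_row t (ent1 j) < entry_row t (ent1 i) < entry_row t (ent0 i))%N ->
  swap i (swap j (swap i t)) = swap j (swap i (swap j t)).
Proof.
move=> /andP[r21 r10]; have e1 := ent0_next; have [n01 n12 n02] := ent_adjacent.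
have [|a0 a1 a2] := @adjacent_swap_low t; first by lia.
have [|b0 b1 b2] := @adjacent_swap_high t; first by lia.
have [|c0 c1 _] := @adjacent_swap_high (swap i t); first by lia.
have [|_ d1 d2] := @adjacent_swap_low (swap j t); first by lia.
apply: (@word_inj _ _ _ (row_shapeE a) (@row_box_inj n a)).
rewrite -!/(row_word _) !row_word_swap ?e1; try lia.
by apply/permP => k; rewrite !permM; apply: tperm_braid.
Qed.

End Adjacent.

(** Two choices of descent reach a common tableau, after one further exchange each if they are far
    apart and two if adjacent; the commutation or braid relation then equates the values. *)
Lemma row_lift_desc i t : desc i t ->
  row_lift t = hpibar F i *: row_lift (swap i t).
Proof.
elim/row_lift_ind: t i => t IH i di; case: row_liftP => [j dj|/(_ i)]; last by lia.
have far k l (dk : desc k t) (dl : desc l t) : (k.+1 < l)%N ->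
    hpibar F k *: row_lift (swap k t) = hpibar F l *: row_lift (swap l t).
  move=> kl.
  have [n00 n01 n10 n11] : [/\ ent0 l != ent0 k, ent0 l != ent1 k,
    ent1 l != ent0 k & ent1 l != ent1 k] by rewrite -!val_eqE /=; split; lia.
  have [wk wl] := (row_weight_swap dk, row_weight_swap dl).
  have dkl : desc l (swap k t) by rewrite !row_swapD ?desc_neq.
  have dlk : desc k (swap l t) by rewrite !row_swapD ?desc_neq // eq_sym.
  rewrite (IH _ wk l dkl) (IH _ wl k dlk) !scalerA hpibar_comm //.
  by rewrite (swap_comm kl) ?desc_neq.
have near k l (dk : desc k t) (dl : desc l t) : l = k.+1 :> nat ->
    hpibar F k *: row_lift (swap k t) = hpibar F l *: row_lift (swap l t).
  move=> kl; have e1 := ent0_next kl; have := dl; rewrite e1 => r21.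
  have [|a0 a1 a2] := @adjacent_swap_low k l kl t; first by lia.
  have [|b0 b1 b2] := @adjacent_swap_high k l kl t; first by lia.
  have [|c0 c1 _] := @adjacent_swap_high k l kl (swap k t); first by lia.
  have [|_ d1 d2] := @adjacent_swap_low k l kl (swap l t); first by lia.
  have dkl : desc l (swap k t) by rewrite e1; lia.
  have dlk : desc k (swap l t) by lia.
  have [wk wl] := (row_weight_swap dk, row_weight_swap dl).
  have [wkl wlk] := (row_weight_swap dkl, row_weight_swap dlk).
  rewrite (IH _ wk l dkl) (IH _ wl k dlk).
  rewrite (IH _ (ltn_trans wkl wk) k) ?(IH _ (ltn_trans wlk wl) l) ?e1; try lia.
  by rewrite !scalerA -!mulrA hpibar_braid // swap_braid //; lia.
case: (ltngtP i j) => [ij|ji|/val_inj -> //].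
- have [|ij1] := ltnP i.+1 j; [by move=> ?; rewrite (far i j)|].
  by rewrite (near i j) //; lia.
- have [|ij1] := ltnP j.+1 i; [by move=> ?; rewrite (far j i)|].
  by rewrite (near j i) //; lia.
Qed.

(** In the sorted tableau i and i+1 are neighbours in a row, so [u_killed] applies. Otherwise split
    off a descent j: pibar_i commutes past a far pibar_j, while for adjacent ones pibar_i pibar_j
    pibar_i = pibar_j pibar_i pibar_j acts on the value at a lighter tableau with j, j+1 in one
    row. *)
Lemma row_lift_same i t : entry_row t (ent0 i) = entry_row t (ent1 i) ->
  hpibar F i *: row_lift t = 0.
Proof.
elim/row_lift_ind: t i => t IH i si; case: row_liftP => [j dj|sorted]; last first.
  apply: u_killed; have pos_id := row_pos_id sorted.
  move: si; rewrite !row_entry_row !pos_id /= row_atS; case: (_ \in _) => //; lia.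
have wj := row_weight_swap dj.
have far k : entry_row t (ent0 k) = entry_row t (ent1 k) ->
    ent0 k != ent0 j -> ent0 k != ent1 j -> ent1 k != ent0 j -> ent1 k != ent1 j ->
    hpibar F k *: row_lift (swap j t) = 0.
  by move=> sk k0 k1 k2 k3; apply: IH wj _ _; rewrite !row_swapD ?desc_neq.
case: (ltngtP i j) => [ij|ji|/val_inj ij]; last by move: si dj; rewrite ij; lia.
- have [ij1|ij1] := ltnP i.+1 j.
    by rewrite scalerA hpibar_comm // -scalerA far ?scaler0 // -val_eqE /=; lia.
  have {}ij : j = i.+1 :> nat by lia.
  have := dj; rewrite (ent0_next ij) => r21.
  have [|b0 b1 b2] := @adjacent_swap_high i j ij t; first by lia.
  have [|_ d1 d2] := @adjacent_swap_low i j ij (swap j t); first by lia.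
  have dij : desc i (swap j t) by lia.
  have wij := row_weight_swap dij.
  rewrite (row_lift_desc dij) !scalerA -mulrA hpibar_braid // -!scalerA.
  rewrite (IH _ (ltn_trans wij wj) j) ?scaler0 // (ent0_next ij); lia.
- have [ji1|ji1] := ltnP j.+1 i.
    by rewrite scalerA -hpibar_comm // -scalerA far ?scaler0 // -val_eqE /=; lia.
  have {}ji : i = j.+1 :> nat by lia.
  move: si; rewrite (ent0_next ji) => si.
  have [|a0 a1 a2] := @adjacent_swap_low j i ji t; first by lia.
  have [|c0 c1 _] := @adjacent_swap_high j i ji (swap j t); first by lia.
  have dij : desc i (swap j t) by rewrite (ent0_next ji); lia.
  have wij := row_weight_swap dij.
  rewrite (row_lift_desc dij) !scalerA -mulrA -hpibar_braid // -!scalerA.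
  by rewrite (IH _ (ltn_trans wij wj) j) ?scaler0 //; lia.
Qed.

Lemma row_lift_linear : linear (tab_ext row_lift).
Proof.
apply: tab_ext_linear => [i t di|i t|i t lt_row].
- by rewrite (row_lift_desc di) scalerA hpibar_idem scaleNr.
- exact: row_lift_same.
- have neq_row : entry_row t (ent0 i) != entry_row t (ent1 i) by lia.
  rewrite [RHS](@row_lift_desc i) ?row_swapK //.
  by rewrite row_swap0 // row_swap1.
Qed.

Lemma row_lift_reading t : (forall k, row_pos t k = k) -> row_lift t = u.
Proof.
move=> pos_id; case: row_liftP => // i; rewrite !row_entry_row !pos_id ltnNge.
by rewrite leq_row_at.
Qed.

End RowLift.

(** * M_alpha as an induced module *)

Section InducedLift.
Variables (B A : nzRingType) (phi : {rmorphism B -> A}) (N : lmodType B).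
Variables (W : lmodType A) (g : N -> W).
Hypotheses (gD : {morph g : v w / v + w})
  (gZ : forall b v, g (b *: v) = phi b *: g v).

(** The universal property of the tensor product on terms; [gZ] makes it respect the balancing
    relation. *)
Fixpoint tterm_lift (t : tterm A N) : W :=
  match t with
  | TPure a v => a *: g v
  | TZero => 0
  | TOpp t => - tterm_lift t
  | TAdd t u => tterm_lift t + tterm_lift u
  end.

Lemma tterm_lift_teq t u : teq phi t u -> tterm_lift t = tterm_lift u.
Proof.
elim=> {t u} //=.
- by move=> t u v _ -> _ ->.
- by move=> t t' _ ->.
- by move=> t t' u u' _ -> _ ->.
- by move=> t u v; rewrite addrA.
- by move=> t u; rewrite addrC.
- by move=> t; rewrite add0r.
- by move=> t; rewrite addNr.
- by move=> a a' v; rewrite scalerDl.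
- by move=> a v v'; rewrite gD scalerDr.
- by move=> a b v; rewrite gZ scalerA.
Qed.

Definition induced_lift (x : induced phi N) : W := tterm_lift (repr x).

Lemma induced_liftE t : induced_lift (ind_term phi t) = tterm_lift t.
Proof. exact/tterm_lift_teq/teq_repr. Qed.

Lemma induced_lift_tens a v : induced_lift (tens phi a v) = a *: g v.
Proof. exact: induced_liftE. Qed.

Lemma induced_lift_linear : linear induced_lift.
Proof.
move=> a; elim/ind_ind=> t; elim/ind_ind=> u.
rewrite -[_ + _]/(ind_add _ _) -[_ *: ind_term phi t]/(ind_scale _ _).
rewrite ind_scaleE ind_addE !induced_liftE /=; congr (_ + _).
by elim: t => [b v||t /= ->|t /= -> t' ->] /=;
  rewrite ?scalerA ?scaler0 ?scalerN ?scalerDr.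
Qed.

Lemma induced_ext (h h' : {linear induced phi N -> W}) :
  (forall v, h (tens phi 1 v) = h' (tens phi 1 v)) -> h =1 h'.
Proof.
move=> hh'; elim/ind_ind; elim=> [a v||t IHt|t IHt u IHu].
- by rewrite -[ind_term _ _]/(tens phi a v) -[a]mulr1 -tensZ !linearZ /= hh'.
- by rewrite -[ind_term _ _]/(0 : induced phi N) !linear0.
- by rewrite -ind_oppE -[ind_opp _]/(- ind_term phi t) !linearN /= IHt.
- rewrite -ind_addE -[ind_add _ _]/(ind_term phi t + ind_term phi u).
  by rewrite !linearD /= IHt IHu.
Qed.

End InducedLift.

(** * The one-dimensional module of a single row *)

Section OneRow.
Variables (F : fieldType) (m : nat).
Hypothesis m_gt0 : (0 < m)%N.
Local Notation tab := (tableau m (gribbon [:: [:: m]])).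

Fact one_row_composition : is_composition m [:: m].
Proof. by rewrite /is_composition inE /= addn0 eqxx; lia. Qed.
Let c := Composition one_row_composition.

(** The one-row ribbon is also the row shape of a one-part composition, so the results on disjoint
    rows apply. *)
Lemma one_row_entry_row (t : tab) k : entry_row t k = 0%N.
Proof.
apply: etrans (@row_entry_row m c t k) _.
by apply/eqP; rewrite eqn0Ngt -has_count; apply/hasP => -[].
Qed.

Lemma one_row_tableau : exists t0 : tab, forall t, t = t0.
Proof.
have [t0 t0_id] := row_reading_tableau c; exists t0 => t.
apply: (@word_inj _ _ _ (row_shapeE c) (@row_box_inj m c)).
apply: invg_inj; apply/permP => k; rewrite -!/(row_pos _) t0_id.
by apply: row_pos_id => i; rewrite !one_row_entry_row.
Qed.

Lemma one_row_P_op i (v : {ffun tab -> F^o}) : P_op i v = v.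
Proof.
rewrite /P_op /bar_op big1 ?add0r // => t _.
by rewrite /bar_basis !one_row_entry_row scaler0.
Qed.

End OneRow.

Section MIsoInduced.
Variables (F : fieldType) (n : nat) (a : composition n).
Local Notation H := (hecke0 F n).
Local Notation B := (parahecke F n a).

(** The scalar comes from the character sending each generator pi_i of H_alpha to 1. It is uniform
    in W because it gets compared in M_alpha and in the tensor product. *)
Lemma parabolic_character (x : H) : in_parabolic a x -> exists c : F,
  forall (W : lmodType H) (w : W),
    (forall i : 'I_n.-1, i.+1 \notin descents a -> hpibar F i *: w = 0) ->
    x *: w = c%:A *: w.
Proof.
elim=> {x} [c|i iD|x y _ [c xc] _ [c' yc]|x y _ [c xc] _ [c' yc]].
- by exists c.
- exists 1 => W w /(_ i iD) /eqP; rewrite /hpibar scalerBl subr_eq0 => /eqP ->.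
  by rewrite scale1r.
- by exists (c + c') => W w kw; rewrite scalerDl xc // yc // -!scalerDl.
- exists (c * c') => W w kw; rewrite -scalerA yc // hscalarC xc // scalerA.
  by rewrite -scalerAl mul1r scalerA mulrC.
Qed.

Lemma P_rows_factor_gt0 (j : 'I_(size a)) : (0 < nth 0%N a j)%N.
Proof.
have /andP[a0 _] := partsP a; rewrite lt0n; apply: contraNneq a0 => <-.
exact: mem_nth.
Qed.

(** Generators of the factors act as the identity by [one_row_P_op]; for i+1 in D(a) the default
    action is the identity too. *)
Lemma P_rows_outer_op (i : 'I_n.-1) w :
  outer_op (fun j : 'I_(size a) =>
    P_action F (nth 0%N a j) (gribbon [:: [:: nth 0%N a j]])) i w = w.
Proof.
case: outer_opP => // p _; apply/ffunP => x; rewrite ffunE /=.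
rewrite one_row_P_op ?P_rows_factor_gt0 // ffunE; congr (w _).
apply/ffunP => k; have [<-|jk] := eqVneq (tag p) k; first by rewrite upd_in.
by rewrite upd_out.
Qed.

Lemma P_rows_basis : exists x0 :
  {dffun forall j : 'I_(size a), tableau (nth 0%N a j) (gribbon [:: [:: nth 0%N a j]])},
  forall x, x = x0.
Proof.
have [f fP] := fin_all_exists (fun j => one_row_tableau (P_rows_factor_gt0 j)).
by exists [ffun j => f j] => x; apply/ffunP => j; rewrite ffunE.
Qed.

Lemma M_comp_iso_induced : module_iso (M_comp F a) (P_rows_ind F a).
Proof.
have [x0 x0P] := P_rows_basis.
have [e e_id] := row_reading_tableau a.
(* [P_rows] is by definition the restriction of the H-module [reg], where the action can be
   computed. *)
pose reg := hmod (outer_action n (fun j : 'I_(size a) =>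
  P_action F (nth 0%N a j) (gribbon [:: [:: nth 0%N a j]]))).
pose e' : M_comp F a := basisv F e.
have e_killed (i : 'I_n.-1) : i.+1 \notin descents a -> hpibar F i *: e' = 0.
  move=> iD; rewrite hpibarE; apply: bar0.
  by rewrite !row_entry_row !e_id /= row_atS (negPf iD) addn0.
have reg_killed (i : 'I_n.-1) (v : reg) : hpibar F i *: v = 0.
  by rewrite scalerBl scale1r hpiE /= P_rows_outer_op subrr.
pose coef (v : P_rows F a) : F := (v : {ffun _ -> F^o}) x0.
(* There is a single index x0, so the constant 1 spans the space. *)
pose v0 : P_rows F a := ([ffun => 1] : {ffun _ -> F^o}).
have regE (c : F) (v : reg) : coef ((c%:A : H) *: v) = c * coef v.
  by rewrite /coef hscalarE ffunE.
have valE (c : F) : val (c%:A : B) = c%:A by rewrite linearZ rmorph1.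
have scalarE (c : F) (v : P_rows F a) : coef ((c%:A : B) *: v) = c * coef v.
  rewrite -[_ *: v]/(res_scale _ _) /res_scale valE.
  exact: regE.
have v0E v : v = ((coef v)%:A : B) *: v0.
  apply/ffunP => x; rewrite (x0P x) -[LHS]/(coef v) -[RHS]/(coef _) scalarE.
  by rewrite /coef ffunE mulr1.
pose g (v : P_rows F a) : M_comp F a := ((coef v)%:A : H) *: e'.
have gD : {morph g : v w / v + w}.
  by move=> v w; rewrite /g -scalerDl -scalerDl /coef ffunE.
have gZ (b : B) v : g (b *: v) = val b *: g v.
  have /asboolP/parabolic_character [c bc] := valP b.
  rewrite /g hscalarC bc // scalerA -scalerAl mul1r scalerA -[b *: v]/(res_scale b v).
  rewrite /res_scale (bc reg) => [|i _]; last exact: reg_killed.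
  by rewrite regE mulrC.
pose u : P_rows_ind F a := tens val 1 v0.
have u_killed (i : 'I_n.-1) : i.+1 \notin descents a -> hpibar F i *: u = 0.
  move=> iD; have iB : hpibar F i \in parabolic a.
    apply/asboolP; rewrite /hpibar -scaleN1r.
    by apply: para_add (para_gen _ iD) (para_scalar _ _ _).
  pose b : B := Parahecke iB.
  rewrite tensZ mulr1 -[hpibar F i]mul1r -[hpibar F i]/(val b) tens_balanced.
  have -> : b *: v0 = 0 by apply: reg_killed.
  by apply: (addrI (tens val 1 0)); rewrite -tensDr !addr0.
have [Phi PhiE] : exists P : {linear P_rows_ind F a -> M_comp F a},
    P =1 induced_lift g.
  by exists (HB.pack (induced_lift g)
    (GRing.isLinear.Build _ _ _ _ _ (induced_lift_linear gD gZ))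
    : {linear P_rows_ind F a -> M_comp F a}).
have [Theta ThetaE] : exists P : {linear M_comp F a -> P_rows_ind F a},
    P =1 tab_ext (row_lift u).
  by exists (HB.pack (tab_ext (row_lift u))
    (GRing.isLinear.Build _ _ _ _ _ (row_lift_linear u_killed))
    : {linear M_comp F a -> P_rows_ind F a}).
have Theta_basis t : Theta (basisv F t) = row_lift u t.
  by rewrite ThetaE tab_ext_basisv.
have Phi_tens c v : Phi (tens val c v) = c *: g v.
  by rewrite PhiE induced_lift_tens.
exists Theta; exists Phi.
(* Applying pibar_i to s_i t gives back t, which undoes each step of the recursion; it stops only at
   the sorted tableau e. *)
- have Phi_Theta_basis t : Phi (row_lift u t) = basisv F t.
    elim/row_lift_ind: t => t IH; case: row_liftP => [i di|sorted].
      have neq_row : entry_row t (ent0 i) != entry_row t (ent1 i) by apply: desc_neq.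
      rewrite linearZ /= IH ?row_weight_swap // hpibarE barL ?row_swapK //.
      by rewrite row_swap0 // row_swap1.
    rewrite Phi_tens scale1r /g /coef ffunE scale1r scale1r.
    congr basisv; apply: (@word_inj _ _ _ (row_shapeE a) (@row_box_inj n a)).
    apply: invg_inj; apply/permP => k; rewrite -!/(row_pos _) e_id.
    by rewrite row_pos_id.
  suff : (Phi \o Theta) =1 idfun by [].
  apply: tab_linear_ext => t.
  exact: etrans (congr1 Phi (Theta_basis t)) (Phi_Theta_basis t).
- suff : (Theta \o Phi) =1 idfun by [].
  apply: induced_ext => v; apply: etrans (congr1 Theta (Phi_tens 1 v)) _.
  have Theta_e : Theta e' = u by apply: etrans (Theta_basis e) _; rewrite row_lift_reading.
  rewrite scale1r /g linearZ Theta_e; apply: etrans (tensZ _ _ _ _) _.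
  rewrite mulr1 [v in RHS]v0E /= -tens_balanced mul1r.
  by congr tens; apply/esym/valE.
Qed.

End MIsoInduced.

(** * Unions of rows *)

Definition inversions n (p : {perm 'I_n}) : {set 'I_n * 'I_n} :=
  [set kl : 'I_n * 'I_n | (kl.1 < kl.2)%N && (p kl.2 < p kl.1)%N].

(** Equal inversion sets mean that p and q order every pair of images alike, so p^-1 followed by q
    is increasing. *)
Lemma inversions_inj n : injective (@inversions n).
Proof.
move=> p q pq; have lt_pq k l : (p k < p l)%N -> (q k < q l)%N.
  case: (ltngtP k l) => [kl|lk|/val_inj ->]; last by rewrite !ltnn.
    move=> lt_p; rewrite ltnNge leq_eqVlt negb_or; apply/andP; split.
      by rewrite (inj_eq val_inj) (inj_eq perm_inj) -(inj_eq val_inj) /=; lia.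
    have /setP/(_ (k, l)) := pq; rewrite !inE kl /= ltnNge (ltnW lt_p) /=.
    by move=> <-.
  by move=> lt_p; have /setP/(_ (l, k)) := pq; rewrite !inE lk lt_p /= => <-.
suff pq1 : (p^-1 * q = 1)%g by rewrite -[q]mul1g -(mulgV p) -mulgA pq1 mulg1.
apply/permP => k; rewrite perm1; apply: (perm_homo_id (p := (p^-1 * q)%g)).
by move=> {}k l kl; rewrite !permM lt_pq // !permKV.
Qed.

(** * The maps from P_beta to M_alpha *)

Section Coarsening.
Variables (F : fieldType) (n : nat) (b a : composition n).
Hypothesis ba : coarsens b a.
Implicit Types (t : tableau n (ribbon_shape b)) (s : tableau n (row_shape a)).

(* The rows of t contain the same entries as the corresponding unions of rows *)
(* of s.                                                                      *)
Definition related t s : bool :=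
  [forall k, row_at b (row_pos s k) == entry_row t k].

Lemma relatedE t s k : related t s -> row_at b (row_pos s k) = entry_row t k.
Proof. by move=> /forallP/(_ k)/eqP. Qed.

Lemma related_lt t s k l : related t s ->
  (entry_row t k < entry_row t l)%N -> (entry_row s k < entry_row s l)%N.
Proof.
by move=> ts; rewrite -!(relatedE _ ts) !row_entry_row; apply: row_at_coarsens_lt.
Qed.

Lemma related_swap t s i : related t s ->
  (entry_row t (ent0 i) < entry_row t (ent1 i))%N -> related (swap i t) (swap i s).
Proof.
move=> ts lt_row; apply/forallP => k; rewrite entry_row_swap // row_pos_swap.
  by rewrite (relatedE _ ts).
by have := related_lt ts lt_row; lia.
Qed.

Lemma related_swapV t s i : related (swap i t) s ->
  (entry_row t (ent0 i) < entry_row t (ent1 i))%N -> related t (swap i s).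
Proof.
move=> ts lt_row.
have lt_row' : (entry_row (swap i t) (ent1 i) < entry_row (swap i t) (ent0 i))%N.
  by rewrite !entry_row_swap // tpermL tpermR.
apply/forallP => k; rewrite row_pos_swap.
  by rewrite (relatedE _ ts) entry_row_swap // tpermK.
by have := related_lt ts lt_row'; lia.
Qed.

Lemma related_swap_same t s i : related t s ->
  entry_row t (ent0 i) = entry_row t (ent1 i) ->
  entry_row s (ent0 i) != entry_row s (ent1 i) -> related t (swap i s).
Proof.
move=> ts eq_row neq_row; apply/forallP => k; rewrite row_pos_swap //.
by rewrite (relatedE _ ts); case: tpermP => [->|->|//]; rewrite eq_row.
Qed.

Definition related_sum t : M_comp F a := \sum_(s | related t s) basisv F s.

Lemma related_sumE t s : (related_sum t : {ffun _ -> F^o}) s = (related t s)%:R.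
Proof.
rewrite /related_sum sum_ffunE; case ts: (related t s).
  rewrite (bigD1 s) //= ffunE eqxx big1 ?addr0 // => u /andP[_ us].
  by rewrite ffunE eq_sym (negPf us).
rewrite big1 // => u tu; rewrite ffunE; case: eqP => // su.
by rewrite su tu in ts.
Qed.

(** If i is above i+1 in t, it is so in every related s. If they share a row of t, the s with both
    in one row are killed and the others cancel in pairs s, s_i s. If i is below i+1, exchanging
    them maps the tableaux related to t bijectively to those related to s_i t. *)
Lemma related_sum_linear : linear (tab_ext related_sum).
Proof.
apply: tab_ext_linear => i t row_t; rewrite /related_sum scaler_sumr.
- rewrite -sumrN; apply: eq_bigr => s ts.
  by rewrite hpibarE barH ?(related_lt ts).
- rewrite (bigID (fun s => entry_row s (ent0 i) < entry_row s (ent1 i))%N) /=.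
  rewrite addrC (bigID (fun s => entry_row s (ent1 i) < entry_row s (ent0 i))%N) /=.
  rewrite [X in _ + X + _]big1 => [|s /andP[/andP[_ ge_row] le_row]]; last first.
    by rewrite hpibarE bar0 //; move: ge_row le_row; case: ltngtP.
  rewrite addr0.
  rewrite (eq_bigr (fun s => - (basisv F s : M_comp F a))) => [|s /andP[_ gt_row]].
    2: by rewrite hpibarE barH.
  rewrite sumrN; apply/eqP; rewrite addrC subr_eq0; apply/eqP.
  rewrite (eq_bigr (fun s => basisv F (swap i s) : M_comp F a)) => [|s /andP[_ lt_row]].
    2: by rewrite hpibarE barL.
  symmetry; rewrite (reindex_onto (@swap _ _ i) (@swap _ _ i)) /=; last first.
    by move=> s /andP[_ gt_row]; rewrite row_swapK //; lia.
  apply: eq_bigl => s; apply/idP/idP.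
    move=> /andP[/andP[/andP[ts _] gt_row] /eqP swapK].
    have neq_row : entry_row (swap i s) (ent0 i) != entry_row (swap i s) (ent1 i).
      by lia.
    have := related_swap_same ts row_t neq_row; rewrite swapK => -> /=.
    by rewrite -swapK (row_swap0 neq_row) (row_swap1 neq_row).
  move=> /andP[ts lt_row]; have neq_row := ltn_eqF lt_row.
  rewrite related_swap_same ?row_swap0 ?row_swap1 ?neq_row //=.
  by rewrite lt_row -leqNgt (ltnW lt_row) row_swapK ?eqxx ?neq_row.
- rewrite (eq_bigr (fun s => basisv F (swap i s) : M_comp F a)) => [|s ts].
    2: by rewrite hpibarE barL ?(related_lt ts).
  symmetry; rewrite (reindex_onto (@swap _ _ i) (@swap _ _ i)) /=.
    apply: eq_bigl => s; apply/idP/idP => [/andP[ts /eqP swapK]|ts].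
      by rewrite -swapK; apply: related_swapV.
    have := related_lt ts row_t; rewrite related_swap //= => lt_row.
    by rewrite row_swapK //; lia.
  move=> s ts; rewrite row_swapK //.
  have : (entry_row s (ent1 i) < entry_row s (ent0 i))%N; last by lia.
  by apply: related_lt ts _; rewrite !entry_row_swap // tpermL tpermR.
Qed.

Lemma related_word t s : row_word s = ribbon_word t -> related t s.
Proof.
move=> st; apply/forallP => k.
by rewrite ribbon_entry_row /row_pos /ribbon_pos /pos -!/(row_word _) st.
Qed.

(** Entries increase along rows, so an inverted pair of t lies in distinct rows of t, hence in
    distinct merged rows of s in the same order. *)
Lemma related_inversions t s : related t s ->
  inversions (ribbon_pos t) \subset inversions (row_pos s).
Proof.
move=> ts; apply/subsetP => -[k l]; rewrite !inE /= => /andP[kl lt_pos].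
rewrite kl; apply: (@row_at_lt b); rewrite !(relatedE _ ts) !ribbon_entry_row.
rewrite ltn_neqAle leq_row_at ?(ltnW lt_pos) // andbT; apply/eqP => rows.
have := @ribbon_word_incr n b t _ _ rows lt_pos.
by rewrite /ribbon_pos /pos !permKV; lia.
Qed.

Lemma related_lt_inversions t s : related t s -> row_word s != ribbon_word t ->
  (#|inversions (ribbon_pos t)| < #|inversions (row_pos s)|)%N.
Proof.
move=> ts neq; rewrite proper_card // properEneq related_inversions // andbT.
by apply: contra neq => /eqP/inversions_inj/invg_inj st; apply/eqP/esym.
Qed.

Lemma row_tableau_of_ribbon t : exists s, row_word s = ribbon_word t.
Proof.
apply: row_tableau_of_word => p q pq; apply: ribbon_word_incr.
exact: row_at_coarsens_eq ba pq.
Qed.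

End Coarsening.

(** Let D(b) be the descent set of the word of s; descents can occur only between rows, that is, in
    D(a). *)
Lemma ribbon_of_row_tableau n (a : composition n) (s : tableau n (row_shape a)) :
  exists2 b : composition n, coarsens b a &
    exists t : tableau n (ribbon_shape b), row_word s = ribbon_word t.
Proof.
set w := row_word s; pose D (d : nat) := [exists p : 'I_n, exists q : 'I_n,
  [&& q == d :> nat, p.+1 == d & (w q < w p)%N]].
have [b bD] := composition_of_descents n D; exists b.
  apply/allP => d /=; rewrite bD => /andP[_ /existsP[p /existsP[q]]].
  move=> /and3P[/eqP qd /eqP pd]; apply: contraTT => dN.
  have := row_atS a p; rewrite pd (negPf dN) addn0 -qd => rows.
  by rewrite -leqNgt ltnW // /w row_word_incr //; lia.
have [|t tw] := @ribbon_tableau_of_word n b w; last by exists t.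
move=> p q qp; rewrite bD; apply/idP/andP => [wqp|[_]].
  split; first by have := ltn_ord q; lia.
  by apply/existsP; exists p; apply/existsP; exists q; rewrite qp !eqxx.
move=> /existsP[p' /existsP[q' /and3P[/eqP q'p /eqP [/val_inj p'p] w']]].
by rewrite -p'p (_ : q = q') //; apply: val_inj; rewrite /= qp q'p.
Qed.

Lemma ribbon_word_composition n (b b' : composition n)
    (t : tableau n (ribbon_shape b)) (t' : tableau n (ribbon_shape b')) :
  ribbon_word t = ribbon_word t' -> b = b'.
Proof.
move=> tt'; apply: descents_inj => d.
have [lt_d|] := boolP (0 < d < n)%N.
  have lt_p : (d.-1 < n)%N by lia.
  have lt_q : (d < n)%N by lia.
  have dE : d = (Ordinal lt_p).+1 by rewrite /=; lia.
  have := ribbon_word_desc t (p := Ordinal lt_p) (q := Ordinal lt_q) dE.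
  by rewrite tt' (ribbon_word_desc t') // -dE => ->.
move=> dN; have bounds (c : composition n) : (d \in descents c) = false.
  have /andP[c0 /eqP cn] := partsP c; apply: contraNF dN => /(descents_bounds c0).
  by rewrite cn.
by rewrite !bounds.
Qed.

(** * The decomposition of M_alpha *)

Section Decomposition.
Variables (F : fieldType) (n : nat) (a : composition n).
Local Notation H := (hecke0 F n).
Local Notation I := {b : composition n | coarsens b a}.

Definition sum_to_M (x : P_sum F a) : M_comp F a :=
  \sum_(b : I) tab_ext (@related_sum F n (val b) a) (x b).

Lemma sum_to_M_linear : linear sum_to_M.
Proof.
move=> h x y; rewrite /sum_to_M scaler_sumr -big_split; apply: eq_bigr => b _ /=.
by rewrite ffunE ffunE (@related_sum_linear F _ _ _ (valP b)).
Qed.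

Lemma sum_to_ME x s : (sum_to_M x : {ffun _ -> F^o}) s
  = \sum_(b : I) \sum_t (x b : {ffun _ -> F^o}) t * (related t s)%:R.
Proof.
rewrite /sum_to_M sum_ffunE; apply: eq_bigr => b _.
rewrite /tab_ext sum_ffunE; apply: eq_bigr => t _.
by rewrite hscalarE ffunE related_sumE.
Qed.

(** At the s with the word of t, the coefficient of the image is that of x at t plus coefficients at
    tableaux with strictly fewer inversions, zero by induction. *)
Lemma sum_to_M_eq0 x : sum_to_M x = 0 -> x = 0.
Proof.
move=> x0; apply/ffunP => b; rewrite [RHS]ffunE; apply/ffunP => t; rewrite [RHS]ffunE.
have [m] := ubnP #|inversions (ribbon_pos t)|.
elim: m b t => // m IHm b t tm.
have [s st] := row_tableau_of_ribbon (valP b) t.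
have /ffunP/(_ s) := x0; rewrite sum_to_ME [RHS]ffunE.
have small (b' : I) (t' : tableau n (ribbon_shape (val b'))) :
    related t' s -> ribbon_word t' != ribbon_word t ->
    (x b' : {ffun _ -> F^o}) t' = 0.
  move=> ts neq; apply: IHm; rewrite -ltnS; apply: leq_trans tm.
  have := related_lt_inversions (valP b') ts; rewrite st eq_sym => /(_ neq).
  by rewrite /row_pos /pos -/(row_word s) st.
rewrite (bigD1 b) //= (bigD1 t) //= related_word // mulr1.
rewrite big1 => [|t' t't]; last first.
  case ts: (related t' s); last by rewrite mulr0.
  by rewrite small ?mul0r //; apply: contra t't => /eqP/word_inj ->.
rewrite big1 => [|b' b'b]; first by rewrite !addr0.
rewrite big1 // => t' _; case ts: (related t' s); last by rewrite mulr0.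
rewrite small ?mul0r //; apply: contra b'b => /eqP/ribbon_word_composition b'b.
exact/eqP/val_inj.
Qed.

(** Downward induction on inversions: the image of the ribbon tableau with the word of s is s plus
    tableaux with strictly more inversions. *)
Lemma sum_to_M_basis s : exists x, sum_to_M x = basisv F s.
Proof.
pose L : {linear P_sum F a -> M_comp F a} :=
  HB.pack sum_to_M (GRing.isLinear.Build _ _ _ _ _ sum_to_M_linear).
suff [x Lx] : exists x, L x = basisv F s by exists x.
have [m] := ubnP (#|{: 'I_n * 'I_n}| - #|inversions (row_pos s)|).
elim: m s => // m IHm s sm.
have [b ba [t st]] := ribbon_of_row_tableau s.
pose v : forall c : I, P_ribbon F (val c) :=
  dfwith (fun c : I => 0 : P_ribbon F (val c))
    (basisv F t : P_ribbon F (val (Sub b ba : I))).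
pose x : P_sum F a := [ffun c => v c].
have Lx : L x = related_sum F a t.
  rewrite -[L _]/(sum_to_M _) /sum_to_M /x (bigD1 (Sub b ba : I)) //=.
  rewrite ffunE /v dfwith_in big1 => [|c cb]; last first.
    rewrite ffunE dfwith_out 1?eq_sym //.
    by rewrite /tab_ext big1 // => u _; rewrite ffunE scale0r scale0r.
  by rewrite addr0 tab_ext_basisv.
have [y Ly] : exists y, L y = \sum_(u | related t u && (u != s)) basisv F u.
  elim/big_rec: _ => [|u w /andP[tu us] [y Ly]].
    by exists 0; rewrite linear0.
  have [|z Lz] := IHm u; last by exists (z + y); rewrite linearD Ly Lz.
  have lt_inv : (#|inversions (row_pos s)| < #|inversions (row_pos u)|)%N.
    have neq : row_word u != ribbon_word t.
      by rewrite -st; apply: contra us => /eqP/word_inj ->.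
    have posE : row_pos s = ribbon_pos t by rewrite /row_pos /pos -/(row_word s) st.
    by rewrite posE related_lt_inversions.
  rewrite -ltnS; apply: leq_trans sm; rewrite ltnS ltn_sub2l //.
  by apply: leq_trans lt_inv _; apply: max_card.
exists (x - y); rewrite linearB Lx Ly.
by rewrite /related_sum (bigD1 s) ?related_word //= addrK.
Qed.

Lemma P_sum_iso_M_comp : module_iso (P_sum F a) (M_comp F a).
Proof.
have [L LE] : exists L : {linear P_sum F a -> M_comp F a}, L =1 sum_to_M.
  by exists (HB.pack sum_to_M (GRing.isLinear.Build _ _ _ _ _ sum_to_M_linear)
    : {linear P_sum F a -> M_comp F a}).
exists L.
have L_inj : injective L.
  move=> x y Lxy; apply/eqP; rewrite -subr_eq0; apply/eqP/sum_to_M_eq0.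
  by rewrite -LE linearB Lxy subrr.
have L_surj y : exists x, L x = y.
  have [f fE] := fin_all_exists sum_to_M_basis.
  exists (tab_ext f y); rewrite [in RHS](basisv_expand y).
  rewrite /tab_ext linear_sum; apply: eq_bigr => s _.
  by rewrite linearZ LE fE [LHS]hscalarE.
have [g gK] := choice L_surj.
by exists g => // x; apply: L_inj; rewrite gK.
Qed.

End Decomposition.

(** * Combining the isomorphisms *)

Lemma module_iso_sym (R : nzRingType) (U V : lmodType R) :
  module_iso U V -> module_iso V U.
Proof.
move=> [f [g fK gK]].
have g_linear : linear g.
  by move=> c x y; apply: (can_inj fK); rewrite gK linearP !gK.
by exists (HB.pack g (GRing.isLinear.Build _ _ _ _ _ g_linear) : {linear V -> U});
  exists f.
Qed.

Lemma module_iso_trans (R : nzRingType) (U V W : lmodType R) :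
  module_iso U V -> module_iso V W -> module_iso U W.
Proof.
move=> [f f_bij] [g g_bij]; exists (g \o f : {linear U -> W}).
exact: bij_comp.
Qed.

Theorem corollary3p5 (F : fieldType) (n : nat) (alpha : composition n) :
  module_iso (M_comp F alpha) (P_rows_ind F alpha) /\
  module_iso (P_rows_ind F alpha) (P_sum F alpha).
Proof.
have M_iso := M_comp_iso_induced F alpha; split=> //.
apply: module_iso_trans (module_iso_sym M_iso) _.
exact/module_iso_sym/P_sum_iso_M_comp.
Qed.
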